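(* Let $(X,\Sigma,\mu)$ be a non-atomic probability space and let $T:X\to X$ be an ergodic invertible measure-preserving transformation. Let $0<c<1$ and let $E_c\subset[0,1]$ be a set all of whose elements are $c$-badly approximable numbers and whose upper Minkowski dimension is strictly less than $1/16$. Then for every $f\in L^2(X,\mu)$ there exists a measurable subset $X'\subset X$ with $\mu(X')=1$ such that for every $x\in X'$ \[ \lim_{N\to\infty}\ \sup_{\theta\in E_c}\left|\frac1N\sum_{n=1}^{N} e(n\theta)\, f(T^{n^2}x)\right| = 0 . \]
   Context: Notation: $e(t):=e^{2\pi i t}$. For $0<c<1$, a real number $\theta$ is called $c$-badly approximable if $\left|\theta-\frac pq\right|\ge \frac{c}{q^2}$ for all reduced fractions $\frac pq$. The upper Minkowski (box) dimension of a bounded set $E\subset\mathbb{R}$ is $\limsup_{\varepsilon\to0^+}\frac{\log N(\varepsilon)}{\log(1/\varepsilon)}$, where $N(\varepsilon)$ is the minimal number of intervals of length $\varepsilon$ needed to cover $E$. *)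

(* Defs.v *)
From HB Require Import structures.
From mathcomp Require Import all_boot all_order all_algebra.
From mathcomp Require Export complex.
From mathcomp Require Import all_classical all_reals all_analysis.
Import Order.TTheory GRing.Theory Num.Theory numFieldNormedType.Exports.

Set Implicit Arguments.
Unset Strict Implicit.
Unset Printing Implicit Defensive.

Local Open Scope classical_set_scope.
Local Open Scope complex_scope.
Local Open Scope ring_scope.

Definition e1 (R : realType) (t : R) : R[i] :=
  cos (2 * pi * t) +i* sin (2 * pi * t).

Definition badly_approximable (R : realType) (c theta : R) : Prop :=
  forall (p : int) (q : nat), (0 < q)%N -> coprime `|p|%N q ->
    c / q%:R ^+ 2 <= `|theta - p%:~R / q%:R|.

(* Replacing an interval of length [eps] by its closure preserves the length
   and can only enlarge the covered set, so closed intervals give the same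
   minimal number as arbitrary ones. *)
Definition interval_cover (R : realType) (E : set R) (eps : R) (n : nat) : Prop :=
  exists a : 'I_n -> R, E `<=` \bigcup_(i in [set: 'I_n]) `[a i, a i + eps]%classic.

(* The value is the least admissible [n]; the default 0 is only used when no
   finite cover exists, i.e. never for bounded [E] and [0 < eps]. *)
Definition covering_number (R : realType) (E : set R) (eps : R) : nat :=
  xget 0%N [set n | interval_cover E eps n /\
                    forall m, interval_cover E eps m -> (n <= m)%N].

Definition upper_minkowski_dim (R : realType) (E : set R) : \bar R :=
  limf_esup (fun eps : R =>
    (ln ((covering_number E eps)%:R : R) / ln (1 / eps))%:E) 0^'+.

Section Dynamics.
Context d (X : measurableType d) (R : realType).
Implicit Types (mu : {measure set X -> \bar R}) (T : X -> X).

Definition is_atom mu (A : set X) : Prop :=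
  [/\ measurable A, (0 < mu A)%E &
      forall B, measurable B -> B `<=` A -> mu B = 0%E \/ mu B = mu A].

Definition non_atomic mu : Prop := forall A, ~ is_atom mu A.

Definition measure_preserving mu T : Prop :=
  measurable_fun setT T /\
  forall A, measurable A -> mu (T @^-1` A) = mu A.

Definition measurably_invertible T : Prop :=
  exists S : X -> X, [/\ measurable_fun setT S, cancel T S & cancel S T].

(* Meant for a probability measure [mu], for which "null or conull" reads
   "measure 0 or 1". *)
Definition ergodic mu T : Prop :=
  forall A, measurable A -> T @^-1` A = A -> mu A = 0%E \/ mu A = 1%E.

(* Complex-valued square-integrable functions. Measurability is that of the
   real and imaginary parts. *)
Definition complex_L2 mu (f : X -> R[i]) : Prop :=
  [/\ measurable_fun setT (fun x => complex.Re (f x)),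
      measurable_fun setT (fun x => complex.Im (f x)) &
      (\int[mu]_x ((Normc.normc (f x) ^+ 2)%:E) < +oo)%E].

Definition twisted_square_average T (f : X -> R[i]) (N : nat) (theta : R)
    (x : X) : R[i] :=
  N%:R^-1 * \sum_(1 <= n < N.+1) e1 (n%:R * theta) * f (iter (n ^ 2) T x).

End Dynamics.

(* Main.v *)
(** Let [N = k^16]. For every frequency [theta] that is [c]-badly approximable
    and every real [t], the sum of [e(n theta + n^2 t)] over [1 <= n <= N] has
    size [O(N k^-2)]. If no [q <= k^4] brings [2 q t] within [k^-24] of an integer,
    this is Weyl differencing; otherwise the quadratic phase is nearly
    linear along short progressions modulo the denominator and [theta] keeps
    the linear phase away from the integers. A finite Fourier transform along
    orbits transfers this bound to an L^2 bound [O(k^-4)] for the square of the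
    ergodic averages of length [N], uniformly in [theta].

    The set of frequencies is covered by at most [k^2] intervals of length
    [k^-32], because its dimension is below [1/16 = 2/32]; summing over the net
    leaves [O(k^-2)], which is summable, so the supremum over the net tends to
    0 almost everywhere. Moving from the net to the whole set costs
    [N k^-32 = k^-16], and passing from [k^16] to lengths between [k^16] and
    [(k+1)^16] involves a proportion [O(1/k)] of the terms, whose contribution
    to the square is again [O(k^-2)]. No maximal inequality is needed, and
    neither are bounded approximations of [f]. *)

Require Import Defs.
From mathcomp Require Import all_boot all_order all_algebra ring lra zify.
From mathcomp Require Import all_classical all_reals all_analysis.
From mathcomp Require Import measurable_realfun.
Import Order.TTheory GRing.Theory Num.Theory numFieldNormedType.Exports.

Set Implicit Arguments.
Unset Strict Implicit.
Unset Printing Implicit Defensive.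

Local Open Scope classical_set_scope.
Local Open Scope complex_scope.
Local Open Scope ring_scope.

(** * The modulus on [R[i]] *)

Section ComplexModulus.
Context {R : realType}.
Implicit Types z w : R[i].

Lemma normc_ge0 z : 0 <= Normc.normc z.
Proof. by case: z => a b /=; rewrite sqrtr_ge0. Qed.

Lemma sqr_normc z : Normc.normc z ^+ 2 = complex.Re z ^+ 2 + complex.Im z ^+ 2.
Proof. by case: z => a b /=; rewrite sqr_sqrtr// addr_ge0// sqr_ge0. Qed.

Lemma sqr_normcE z : (Normc.normc z ^+ 2)%:C = z * conjc z.
Proof.
case: z => a b; rewrite sqr_normc /=; apply/eqP; rewrite eq_complex /=.
by apply/andP; split; apply/eqP; ring.
Qed.

Lemma sum_real_complex {I : Type} (r : seq I) (P : pred I) (F : I -> R) :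
  (\sum_(i <- r | P i) F i)%:C = \sum_(i <- r | P i) (F i)%:C :> R[i].
Proof. exact: (rmorph_sum (real_complex R)). Qed.

Lemma conjc_sum {I : Type} (r : seq I) (P : pred I) (F : I -> R[i]) :
  conjc (\sum_(i <- r | P i) F i) = \sum_(i <- r | P i) conjc (F i).
Proof. exact: (rmorph_sum (@conjc R)). Qed.

Lemma Re_sum {I : Type} (r : seq I) (F : I -> R[i]) :
  complex.Re (\sum_(j <- r) F j) = \sum_(j <- r) complex.Re (F j).
Proof.
elim: r => [|j r IH]; rewrite ?big_nil ?big_cons//= -IH.
by case: (F j) (\sum_(_ <- _) _) => [a b] [a' b'].
Qed.

Lemma Im_sum {I : Type} (r : seq I) (F : I -> R[i]) :
  complex.Im (\sum_(j <- r) F j) = \sum_(j <- r) complex.Im (F j).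
Proof.
elim: r => [|j r IH]; rewrite ?big_nil ?big_cons//= -IH.
by case: (F j) (\sum_(_ <- _) _) => [a b] [a' b'].
Qed.

Lemma conjc_mul z w : conjc (z * w) = conjc z * conjc w.
Proof. exact: (rmorphM (@conjc R)). Qed.

Lemma mul_real_complex (x y : R) : (x * y)%:C = x%:C * y%:C :> R[i].
Proof. exact: (rmorphM (real_complex R)). Qed.

Lemma nat_real_complex n : (n%:R)%:C = n%:R :> R[i].
Proof. exact: (rmorph_nat (real_complex R)). Qed.

Lemma normcD_le z w : Normc.normc (z + w) <= Normc.normc z + Normc.normc w.
Proof. exact: le_normcD. Qed.

Lemma normcNE z : Normc.normc (- z) = Normc.normc z.
Proof. exact: normcN. Qed.

Lemma normcB_le z w : Normc.normc (z - w) <= Normc.normc z + Normc.normc w.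
Proof. by rewrite -(normcNE w) normcD_le. Qed.

Lemma normc_conj z : Normc.normc (conjc z) = Normc.normc z.
Proof. by case: z => a b /=; rewrite sqrrN. Qed.

Lemma normc_real (x : R) : Normc.normc x%:C = `|x|.
Proof. by rewrite /= expr0n /= addr0 sqrtr_sqr. Qed.

Lemma normc_nat n : Normc.normc (n%:R : R[i]) = n%:R.
Proof. by rewrite -(rmorph_nat (real_complex R)) normc_real normr_nat. Qed.

Lemma normc_sum {I : Type} (r : seq I) (P : pred I) (F : I -> R[i]) :
  Normc.normc (\sum_(i <- r | P i) F i) <=
  \sum_(i <- r | P i) Normc.normc (F i).
Proof.
elim/big_ind2: _ => [|x1 x2 y1 y2 h1 h2|//]; first by rewrite Normc.normc0.
exact: le_trans (normcD_le _ _) (lerD h1 h2).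
Qed.

Lemma normc_ge_Re z : `|complex.Re z| <= Normc.normc z.
Proof.
by rewrite -(ler_pXn2r (isT : (0 < 2)%N)) ?nnegrE ?normc_ge0// sqr_normc
  real_normK ?num_real// lerDl sqr_ge0.
Qed.

Lemma normc_le_ReDIm z : Normc.normc z <= `|complex.Re z| + `|complex.Im z|.
Proof.
rewrite -(ler_pXn2r (isT : (0 < 2)%N)) ?nnegrE ?normc_ge0 ?addr_ge0//.
rewrite sqr_normc sqrrD !real_normK ?num_real// -addrA lerD2l lerDr.
by rewrite mulrn_wge0// mulr_ge0.
Qed.

End ComplexModulus.

(** * Lipschitz and lower bounds for the phase [e1], and geometric sums *)

Section ExponentialPhase.
Context {R : realType}.
Implicit Types a b : R.

Lemma e1D a b : e1 (a + b) = e1 a * e1 b.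
Proof.
rewrite /e1 mulrDr cosD sinD; apply/eqP; rewrite eq_complex /=.
by apply/andP; split; apply/eqP; ring.
Qed.

Lemma e10 : e1 (0 : R) = 1.
Proof. by rewrite /e1 mulr0 cos0 sin0. Qed.

Lemma e1N a : e1 (- a) = conjc (e1 a).
Proof. by rewrite /e1 mulrN cosN sinN. Qed.

Lemma e1_int (p : int) : e1 (p%:~R : R) = 1.
Proof.
have e1n (n : nat) : e1 (n%:R : R) = 1.
  elim: n => [|n IH]; first by rewrite e10.
  rewrite -addn1 natrD e1D IH mul1r /e1 mulr1 mulr_natl cos2pi sin2pi.
  by apply/eqP; rewrite eq_complex /= !eqxx.
case: (intP p) => [|n|n]; first by rewrite e10.
  by rewrite -pmulrn e1n.
by rewrite mulrNz -pmulrn e1N e1n conjc1.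
Qed.

Lemma normc_e1 a : Normc.normc (e1 a) = 1.
Proof. by rewrite /e1 /= cos2Dsin2 sqrtr1. Qed.

Lemma norm_sin_cos1_le a : `|sin a| <= `|a| /\ `|cos a - 1| <= `|a|.
Proof.
wlog a0 : a / 0 <= a.
  move=> H; have [/H//|a0] := leP 0 a.
  have := H (- a); rewrite oppr_ge0 ltW// sinN cosN !normrN; exact.
have ds (x : R) : x \in `]0, a[ -> is_derive x 1 sin (cos x) by move=> _; exact: is_derive_sin.
have dc (x : R) : x \in `]0, a[ -> is_derive x 1 cos (- sin x) by move=> _; exact: is_derive_cos.
have [|x _ hx] := MVT_segment a0 ds.
  by apply: continuous_subspaceT => x; exact: continuous_sin.
have [|y _ hy] := MVT_segment a0 dc.
  by apply: continuous_subspaceT => y; exact: continuous_cos.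
rewrite sin0 !subr0 in hx; rewrite cos0 subr0 in hy; rewrite hx hy !normrM normrN.
by rewrite !ler_piMl// ?cos_max ?sin_max.
Qed.

(** Sine and cosine each contribute [2 pi |a - b|], and the crude bound [pi <= 4] turns the total
    into 16. *)
Lemma normc_e1_subr_le a b : Normc.normc (e1 a - e1 b) <= 16 * `|a - b|.
Proof.
have -> : e1 a - e1 b = e1 b * (e1 (a - b) - 1).
  by rewrite mulrBr mulr1 -e1D [b + _]addrC subrK.
rewrite Normc.normcM normc_e1 mul1r.
have [h1 h2] := norm_sin_cos1_le (2 * pi * (a - b)).
apply: le_trans (normc_le_ReDIm _) _; rewrite /e1 /= subr0.
apply: le_trans (lerD h2 h1) _.
have pi4 : pi <= 4 :> R by have := @pihalf_lt2 R; lra.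
rewrite normrM ger0_norm ?mulr_ge0 ?pi_ge0//.
have : pi * `|a - b| <= 4 * `|a - b| by rewrite ler_wpM2r.
lra.
Qed.

(** The usual condition ||a|| >= d on the distance to the nearest integer; quantifying over all
    integers avoids choosing a nearest one. *)
Definition int_dist_ge (d a : R) : Prop := forall p : int, d <= `|a - p%:~R|.

Lemma normc_1_sub_e1Mn a n :
  Normc.normc (1 - e1 (n%:R * a)) <= n%:R * Normc.normc (1 - e1 a).
Proof.
elim: n => [|n IH]; first by rewrite !mul0r e10 subrr Normc.normc0.
have -> : 1 - e1 (n.+1%:R * a) = (1 - e1 (n%:R * a)) + e1 (n%:R * a) * (1 - e1 a).
  by rewrite -natr1 mulrDl mul1r e1D; ring.
apply: le_trans (normcD_le _ _) _.
by rewrite Normc.normcM normc_e1 mul1r -natr1 mulrDl mul1r lerD2r.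
Qed.

(* Instead of a lower bound for the sine on a quarter period, multiply [a] by
   an integer [n] that moves it to distance between 1/4 and 1/2 from 0. *)
Lemma normc_1_sub_e1_ge d a : int_dist_ge d a -> d <= Normc.normc (1 - e1 a).
Proof.
move=> ha; pose p := Num.floor (a + 2^-1); pose b := a - p%:~R.
have /andP[b1 b2] : - 2^-1 <= b < 2^-1.
  have := floor_itv (a + 2^-1); rewrite -/p intrD1 /b => /andP[]; lra.
have db : d <= `|b| by exact: ha.
have -> : e1 a = e1 b.
  by rewrite -[a](subrK p%:~R) e1D e1_int mulr1.
have [bz|b0] := eqVneq b 0; first by move: db; rewrite bz e10 subrr Normc.normc0 normr0.
move: {ha} db; set x := `|b| => dx.
have x0 : 0 < x by rewrite normr_gt0.
have xle : x <= 2^-1 by rewrite ler_norml b1 ltW.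
pose n := (Num.truncn (4 * x)^-1).+1.
have /andP[n1 n2] : ((Num.truncn (4 * x)^-1)%:R <= (4 * x)^-1 < n%:R).
  by apply: truncn_itv; rewrite invr_ge0 mulr_ge0// ltW.
have nx1 : 4^-1 < n%:R * x.
  move: n2; rewrite invfM -ltr_pdivrMr//.
have nx2 : n%:R * x <= 2^-1.
  have [x4|x4] := leP x 4^-1.
    rewrite /n -natr1 mulrDl mul1r.
    have : (Num.truncn (4 * x)^-1)%:R * x <= 4^-1.
      by rewrite -ler_pdivlMr// -invfM.
    lra.
  suff -> : n = 1%N by rewrite mul1r.
  rewrite /n; congr S; apply: truncn_def; apply/andP; split.
    by rewrite invr_ge0 mulr_ge0// ltW.
  by rewrite invf_lt1; lra.
(* Since [n x] lies between 1/4 and 1/2, the cosine is nonpositive and the real part of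
   [1 - e1 (n b)] is at least 1. Hence [1 <= n y] with [y] the modulus of [1 - e1 b], and
   [n x <= 1/2] yields [x <= y / 2]. *)
have cosle : cos (2 * pi * (n%:R * b)) <= 0.
  have -> : cos (2 * pi * (n%:R * b)) = cos (2 * pi * (n%:R * x)).
    rewrite -[LHS]cos_norm !normrM -/x; congr cos.
    by rewrite [`|pi|]ger0_norm ?pi_ge0// !normr_nat.
  rewrite -[X in cos X](subrK pi) cosDpi oppr_le0 cos_ge0_pihalf//.
  have p0 := @pi_gt0 R.
  have : pi * 4^-1 <= pi * (n%:R * x) by rewrite ler_pM2l// ltW.
  have : pi * (n%:R * x) <= pi * 2^-1 by rewrite ler_pM2l.
  lra.
have h1 : 1 <= Normc.normc (1 - e1 (n%:R * b)).
  apply: le_trans (normc_ge_Re _); rewrite /e1 /=.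
  by apply: le_trans (ler_norm _); lra.
have h2 := le_trans h1 (normc_1_sub_e1Mn b n).
apply: le_trans dx _; set y := Normc.normc _ in h2 *.
have y0 : 0 <= y by exact: normc_ge0.
have : x <= n%:R * y * x by rewrite ler_peMl// ltW.
have : n%:R * x * y <= 2^-1 * y by rewrite ler_wpM2r.
lra.
Qed.

Lemma geometric_e1 a n :
  (\sum_(0 <= k < n) e1 (k%:R * a)) * (1 - e1 a) = 1 - e1 (n%:R * a).
Proof.
elim: n => [|n IH]; first by rewrite big_nil !mul0r e10 subrr.
rewrite big_nat_recr//= mulrDl IH -natr1 (mulrDl n%:R) mul1r e1D; ring.
Qed.

Lemma geometric_e1_le d a n : 0 < d -> int_dist_ge d a ->
  Normc.normc (\sum_(0 <= k < n) e1 (k%:R * a)) <= 2 / d.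
Proof.
move=> d0 /normc_1_sub_e1_ge ha.
rewrite ler_pdivlMr//.
apply: le_trans (ler_wpM2l (normc_ge0 _) ha) _.
rewrite -Normc.normcM.
rewrite geometric_e1.
by apply: le_trans (normcB_le _ _) _; rewrite Normc.normc1 normc_e1.
Qed.

End ExponentialPhase.

(** * Dirichlet approximation and counting multiples close to integers *)

Section Diophantine.
Context {R : realType}.
Implicit Types t d : R.

Lemma pigeonhole_seq (s : seq nat) (g : nat -> nat) n : uniq s ->
  {in s &, injective g} -> {in s, forall h, (g h < n)%N} -> (size s <= n)%N.
Proof.
move=> us ginj glt; rewrite -(size_map g) -(size_iota 0 n).
apply: uniq_leq_size; first by rewrite map_inj_in_uniq.
by move=> _ /mapP[h hs ->]; rewrite mem_iota add0n glt.
Qed.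

Lemma truncn_eq_dist (x y : R) : 0 <= x -> 0 <= y ->
  Num.truncn x = Num.truncn y -> `|x - y| < 1.
Proof.
move=> x0 y0 e; have := truncn_itv x0; have := truncn_itv y0.
by rewrite e -natr1 ltr_norml => /andP[? ?] /andP[? ?]; apply/andP; split; lra.
Qed.

(** Pigeonhole: among the multiples of [t] by [0, ..., Q], two have fractional parts in the same of
    [Q] boxes of width [1/Q], and the difference of their indices serves as [q]. *)
Lemma dirichlet_approximation t Q : (0 < Q)%N -> exists q,
  (0 < q <= Q)%N /\ exists p : int, `|q%:R * t - p%:~R| <= Q%:R^-1.
Proof.
move=> Q0; apply: contrapT => H.
pose fr h := h%:R * t - (Num.floor (h%:R * t))%:~R.
have fr0 h : 0 <= fr h < 1.
  by have := floor_itv (h%:R * t); rewrite intrD1 /fr => /andP[? ?]; apply/andP; split; lra.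
have Q0R : 0 < Q%:R :> R by rewrite ltr0n.
pose g h := Num.truncn (Q%:R * fr h).
have Qfr h : 0 <= Q%:R * fr h by rewrite mulr_ge0 ?ler0n//; case/andP: (fr0 h).
have: (size (iota 0 Q.+1) <= Q)%N; last by rewrite size_iota ltnn.
apply: (@pigeonhole_seq _ g); first exact: iota_uniq.
- move=> x y; rewrite !mem_iota !add0n /= => xQ yQ.
  wlog xy : x y xQ yQ / (x < y)%N => [W|] e.
    case: (ltngtP x y) => // c; first exact: W.
    by apply/esym; apply: W.
  exfalso; apply: H; exists (y - x)%N; split; first by lia.
  exists (Num.floor (y%:R * t) - Num.floor (x%:R * t)).
  have -> : (y - x)%:R * t - (Num.floor (y%:R * t) - Num.floor (x%:R * t))%:~R
     = fr y - fr x.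
    by rewrite natrB 1?ltnW// rmorphB /= /fr; ring.
  have := truncn_eq_dist (Qfr y) (Qfr x) (esym e).
  rewrite -mulrBr normrM gtr0_norm// => /ltW.
  by rewrite mulrC -ler_pdivlMr// div1r.
- move=> h _; rewrite /g truncn_lt_nat// gtr_pMr//.
  by case/andP: (fr0 h).
Qed.

(* Minimality of [q] makes the multiples of [t] below [q/2] as well spaced as
   if [t] were a fraction with denominator [q]. *)
Lemma dirichlet_minimal t Q : (0 < Q)%N -> exists q,
  [/\ (0 < q <= Q)%N, exists p : int, `|q%:R * t - p%:~R| <= Q%:R^-1 &
      forall d : nat, (0 < d)%N -> (d.*2 <= q)%N -> int_dist_ge (q.*2%:R^-1) (d%:R * t)].
Proof.
move=> Q0.
pose P q := (0 < q)%N && `[< exists p : int, `|q%:R * t - p%:~R| <= Q%:R^-1 >].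
have exP : exists q, P q.
  have [q [/andP[q0 _] qp]] := dirichlet_approximation t Q0.
  by exists q; rewrite /P q0; apply/asboolP.
case: (ex_minnP exP) => q /andP[q0 /asboolP qp] qmin.
have qQ : (q <= Q)%N.
  have [r [/andP[r0 rQ] rp]] := dirichlet_approximation t Q0.
  by apply: leq_trans rQ; apply: qmin; rewrite /P r0; apply/asboolP.
exists q; split => //; first by rewrite q0.
move=> d d0 dq b; rewrite leNgt; apply/negP => lt_b.
have [a ha] := qp.
have Q0R : 0 < Q%:R :> R by rewrite ltr0n.
have q0R : 0 < q%:R :> R by rewrite ltr0n.
have d0R : 0 < d%:R :> R by rewrite ltr0n.
have dqR : 2 * d%:R <= q%:R :> R by rewrite -natrM ler_nat mul2n.
have qQR : q%:R <= Q%:R :> R by rewrite ler_nat.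
have hgam : Q%:R * `|q%:R * t - a%:~R| <= 1.
  by move: ha; rewrite -div1r ler_pdivlMr// mulrC.
have hbet : 2 * (q%:R * `|d%:R * t - b%:~R|) < 1.
  move: lt_b; rewrite -mul2n natrM -div1r ltr_pdivlMr ?mulr_gt0//.
  by rewrite mulrC mulrA.
(* If [d t] were within [1/(2q)] of an integer [b], the integer [q b - d a] would have modulus below
   1, hence vanish. Then [q |bet| = d |gam|], so [b] makes [d] an admissible denominator smaller
   than the minimal [q]. *)
have e : d%:R * (q%:R * t - a%:~R) - q%:R * (d%:R * t - b%:~R)
    = (q%:Z * b - d%:Z * a)%:~R by rewrite rmorphB !rmorphM /=; ring.
set gam := q%:R * t - a%:~R in hgam e.
set bet := d%:R * t - b%:~R in hbet e.
have dgam : 2 * (d%:R * `|gam|) <= 1.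
  rewrite mulrA; apply: le_trans hgam; rewrite ler_wpM2r//; lra.
have z0 : q%:Z * b - d%:Z * a = 0.
  have : `|(q%:Z * b - d%:Z * a)%:~R : R| < 1.
    rewrite -e; apply: le_lt_trans (ler_normB _ _) _.
    by rewrite !normrM !normr_nat; lra.
  by rewrite -intr_norm -[X in _ < X]/(1%:~R) ltr_int; lia.
move: e; rewrite z0 /= => /eqP; rewrite subr_eq0 => /eqP e.
have : (q <= d)%N; last by lia.
apply: qmin; rewrite /P d0; apply/asboolP; exists b; rewrite -/bet.
have : q%:R * `|bet| = d%:R * `|gam|.
  by rewrite -[q%:R]normr_nat -[d%:R]normr_nat -!normrM e.
move=> e'; apply: (@le_trans _ _ `|gam|) => //.
rewrite -(ler_pM2l q0R) e' ler_wpM2r//; lra.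
Qed.

(** Cut the range into blocks of length about [q/2]. Inside a block, the signed deviations of [h t]
    from its near integer differ pairwise by at least [1/(2q)] and lie in an interval of length
    [2d], so at most [4 d q + 1] of them fit. *)
Lemma count_near_integer t d q N : (0 < q)%N -> 0 <= d ->
  (forall e, (0 < e)%N -> (e.*2 <= q)%N -> int_dist_ge (q.*2%:R^-1) (e%:R * t)) ->
  (count (fun h => `[< exists p : int, `|h%:R * t - p%:~R| <= d >]) (iota 1 N))%:R
    <= (2 * N%:R / q%:R + 1) * (4 * d * q%:R + 1).
Proof.
move=> q0 d0 sep; set bad := (X in count X _).
have q0R : 0 < q%:R :> R by rewrite ltr0n.
pose p h := xget 0 [set p : int | `|h%:R * t - p%:~R| <= d].
have pP h : bad h -> `|h%:R * t - (p h)%:~R| <= d.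
  by move=> /asboolP[x hx]; exact: (@xgetI _ 0 [set p : int | _] x hx).
(* Deviations are shifted by [d] to be nonnegative and scaled by [2q] to have separation 1, so that
   their integer parts are distinct inside a block. *)
pose r h := (h%:R * t - (p h)%:~R + d) * (2 * q%:R).
have rP h : bad h -> 0 <= r h <= 4 * d * q%:R.
  move=> /pP; rewrite ler_norml /r => /andP[h1 h2]; apply/andP; split.
    by rewrite mulr_ge0 ?mulr_ge0 ?ler0n//; lra.
  have -> : 4 * d * q%:R = (2 * d) * (2 * q%:R) by ring.
  by rewrite ler_wpM2r ?mulr_ge0 ?ler0n//; lra.
(* Rounding up still gives [2 (y - x) <= q] for two indices of one block, which is the range where
   [sep] applies. *)
pose b := uphalf q; have b0 : (0 < b)%N by rewrite /b uphalf_gt0.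
pose C := (Num.truncn (4 * d * q%:R)).+1.
have dq0 : 0 <= 4 * d * q%:R by rewrite !mulr_ge0 ?ler0n.
have rC h : bad h -> (Num.truncn (r h) < C)%N.
  by move=> /rP/andP[_ ?]; rewrite ltnS le_truncn.
rewrite -size_filter; set s := seq.filter _ _.
have sbad h : h \in s -> bad h /\ (h <= N)%N.
  by rewrite mem_filter mem_iota => /and3P[-> _]; rewrite add1n ltnS.
have cnt : (size s <= (N %/ b + 1) * C)%N.
  apply: (@pigeonhole_seq _ (fun h => h %/ b * C + Num.truncn (r h))%N).
  - by rewrite filter_uniq ?iota_uniq.
  - move=> x y /sbad[bx _] /sbad[by_ _].
    wlog xy : x y bx by_ / (x < y)%N => [W|] e.
      case: (ltngtP x y) => // c; first exact: W.
      by apply/esym; apply: W.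
    have ed : (x %/ b = y %/ b)%N.
      by have := congr1 (divn^~ C) e; rewrite /= !divnMDl// (divn_small (rC _ bx)) (divn_small (rC _ by_)) !addn0.
    have er : Num.truncn (r y) = Num.truncn (r x).
      by move: e; rewrite ed => /addnI.
    have dlt : (y - x < b)%N.
      rewrite (divn_eq x b) (divn_eq y b) ed subnDl.
      by apply: leq_ltn_trans (leq_subr _ _) _; rewrite ltn_pmod.
    have := sep (y - x)%N; rewrite subn_gt0 => /(_ xy).
    have -> : ((y - x).*2 <= q)%N by move: dlt; rewrite /b; lia.
    move=> /(_ isT (p y - p x)).
    have /andP[rx0 _] := rP _ bx; have /andP[ry0 _] := rP _ by_.
    have := truncn_eq_dist ry0 rx0 er.
    have -> : r y - r x = ((y - x)%:R * t - (p y - p x)%:~R) * (2 * q%:R).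
      by rewrite /r natrB 1?ltnW// rmorphB /=; ring.
    rewrite normrM (@gtr0_norm _ (2 * _)) ?mulr_gt0// -ltr_pdivlMr ?mulr_gt0//.
    by rewrite -mul2n natrM div1r => lt1 /(lt_le_trans lt1); rewrite ltxx.
  - move=> h /sbad[bh hN].
    have: (h %/ b <= N %/ b)%N by exact: leq_div2r.
    by have := rC h bh; nia.
apply: (@le_trans _ _ (((N %/ b + 1) * C)%:R)); first by rewrite ler_nat.
rewrite natrM; apply: ler_pM => //; last first.
  by rewrite /C -(natr1 (Num.truncn _)) lerD2r; case/andP: (truncn_itv dq0).
rewrite natrD lerD2r ler_pdivlMr// -!natrM ler_nat.
have := leq_divM N b; have : (q <= 2 * b)%N by rewrite /b; lia.
nia.
Qed.

End Diophantine.

(** * Weyl differencing *)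

Section VanDerCorput.
Context {R : realType}.

(** Regroups a square array by the distance to its diagonal; the induction adds the last row and
    column, whose entries fall one on each diagonal. *)
Lemma sum_square_diagonals {V : nmodType} (a : nat -> nat -> V) N :
  \sum_(0 <= n < N) \sum_(0 <= m < N) a n m =
  \sum_(0 <= n < N) a n n +
  \sum_(0 <= h < N) \sum_(0 <= n < N - h.+1) (a (n + h.+1)%N n + a n (n + h.+1)%N).
Proof.
elim: N => [|N IH]; first by rewrite !big_nil addr0.
rewrite big_nat_recr//= [X in _ + X]big_nat_recr//=.
under eq_bigr do rewrite big_nat_recr//=.
rewrite big_split /= IH [in RHS]big_nat_recr//=.
rewrite [\sum_(0 <= h < N.+1) _]big_nat_recr//= subnn big_nil addr0.
have -> : \sum_(0 <= h < N) \sum_(0 <= n < N.+1 - h.+1) (a (n + h.+1)%N n + a n (n + h.+1)%N)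
  = \sum_(0 <= h < N) \sum_(0 <= n < N - h.+1) (a (n + h.+1)%N n + a n (n + h.+1)%N)
    + \sum_(0 <= h < N) (a N (N - h.+1)%N + a (N - h.+1)%N N).
  rewrite -big_split /=; apply: eq_big_nat => h /andP[_ hN].
  have -> : (N.+1 - h.+1 = (N - h.+1).+1)%N by lia.
  by rewrite big_nat_recr//= subnK.
rewrite [X in _ = _ + (_ + X)]big_nat_rev /= add0n.
have -> : \sum_(0 <= h < N) (a N (N - (N - h.+1).+1)%N + a (N - (N - h.+1).+1)%N N)
  = \sum_(0 <= m < N) a N m + \sum_(0 <= m < N) a m N.
  rewrite -big_split /=; apply: eq_big_nat => h /andP[_ hN].
  by have -> : (N - (N - h.+1).+1 = h)%N by lia.
by rewrite [RHS]addrACA -addrA; congr (_ + _); rewrite addrCA addrA [RHS]addrC.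
Qed.

(** Expand [S] times its conjugate along diagonals: the diagonals at distance [h + 1] on the two
    sides are conjugate to each other, whence the factor 2. *)
Lemma normc_sum_sqr_le (u : nat -> R[i]) N :
  Normc.normc (\sum_(0 <= n < N) u n) ^+ 2 <=
  \sum_(0 <= n < N) Normc.normc (u n) ^+ 2 +
  2 * \sum_(0 <= h < N)
        Normc.normc (\sum_(0 <= n < N - h.+1) u (n + h.+1)%N * conjc (u n)).
Proof.
set S := \sum_(0 <= n < N) u n.
have -> : Normc.normc S ^+ 2 = Normc.normc ((Normc.normc S ^+ 2)%:C).
  by rewrite normc_real ger0_norm// sqr_ge0.
rewrite sqr_normcE /S rmorph_sum /= big_distrl /=.
under eq_bigr do rewrite big_distrr /=.
rewrite (sum_square_diagonals (fun n m => u n * conjc (u m))).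
apply: le_trans (normcD_le _ _) _; apply: lerD.
  apply: le_trans (normc_sum _ _ _) _; apply: ler_sum => n _.
  by rewrite Normc.normcM normc_conj expr2.
rewrite mulr_sumr; apply: le_trans (normc_sum _ _ _) _; apply: ler_sum => h _.
rewrite big_split /=; apply: le_trans (normcD_le _ _) _.
rewrite mulrDl mul1r lerD2l -normc_conj rmorph_sum /=.
under eq_bigr do rewrite rmorphM /= conjcK mulrC.
by [].
Qed.

End VanDerCorput.

(** * Quadratic Weyl sums whose linear frequency is badly approximable *)

Section WeylSum.
Context {R : realType}.
Implicit Types theta t c : R.

Definition weyl_sum theta t (N : nat) : R[i] :=
  \sum_(1 <= n < N.+1) e1 (n%:R * theta + (n ^ 2)%:R * t).

Lemma weyl_sum_le_size theta t N : Normc.normc (weyl_sum theta t N) <= N%:R.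
Proof.
apply: le_trans (normc_sum _ _ _) _; under eq_bigr do rewrite normc_e1.
by rewrite sumr_const_nat subSS subn0.
Qed.

(** Differencing with shift [h] leaves a geometric sum of ratio [e1 (2 h t)], from which [theta] has
    disappeared. Shifts with [2 h t] within [d] of an integer are bounded trivially by [N], all
    others by [2 / d]. *)
Lemma weyl_sum_sqr_le theta t (d : R) N : 0 < d ->
  Normc.normc (weyl_sum theta t N) ^+ 2 <= N%:R + 2 * (N%:R *
    (count (fun h => `[< exists p : int, `|h%:R * (2 * t) - p%:~R| <= d >])
       (iota 1 N))%:R + N%:R * (2 / d)).
Proof.
move=> d0; rewrite /weyl_sum big_add1 /=.
apply: le_trans (normc_sum_sqr_le _ _) _; apply: lerD.
  by under eq_bigr do rewrite normc_e1 expr1n; rewrite sumr_const_nat subn0.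
rewrite ler_wpM2l//; set bad := (X in count X _).
have -> : (count bad (iota 1 N))%:R = \sum_(0 <= h < N) (bad h.+1)%:R :> R.
  rewrite (iotaDl 1 0 N) count_map -sum1_count big_mkcond natr_sum /index_iota subn0.
  by apply: eq_bigr => h _ /=; rewrite add1n; case: (bad _).
have -> : N%:R * (2 / d) = \sum_(0 <= h < N) (2 / d).
  by rewrite sumr_const_nat subn0 mulr_natl.
rewrite mulr_sumr -big_split /=; apply: ler_sum_nat => h /andP[_ hN].
have -> : Normc.normc (\sum_(0 <= n < N - h.+1)
      e1 ((n + h.+1).+1%:R * theta + ((n + h.+1).+1 ^ 2)%:R * t) *
      conjc (e1 (n.+1%:R * theta + (n.+1 ^ 2)%:R * t))) =
    Normc.normc (\sum_(0 <= n < N - h.+1) e1 (n%:R * (h.+1%:R * (2 * t)))).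
  (* [z] is the part of the differenced phase that is constant in [n], so it does not affect the
     modulus. *)
  set z := h.+1%:R * theta + (h.+1%:R ^+ 2 + 2 * h.+1%:R) * t.
  rewrite -[RHS]mul1r -[X in _ = X * _](normc_e1 z).
  rewrite -Normc.normcM mulr_sumr; congr Normc.normc; apply: eq_bigr => n _.
  rewrite -e1N -!e1D; congr e1; rewrite /z !natrX -!natr1 natrD -natr1; ring.
have d2 : 0 <= 2 / d by rewrite divr_ge0// ltW.
case: (boolP (bad h.+1)) => [_|/asboolPn nbad].
  rewrite mulr1; apply: ler_wpDr => //.
  apply: le_trans (normc_sum _ _ _) _; under eq_bigr do rewrite normc_e1.
  by rewrite sumr_const_nat subn0 ler_nat leq_subr.
rewrite mulr0 add0r geometric_e1_le// => p; rewrite leNgt; apply/negP => lt.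
by apply: nbad; exists p; exact: ltW.
Qed.

Lemma weyl_sum_minor theta t k q : (0 < k)%N -> (k ^ 4 < q <= k ^ 24)%N ->
  (forall e : nat, (0 < e)%N -> (e.*2 <= q)%N ->
     int_dist_ge (q.*2%:R^-1) (e%:R * (2 * t))) ->
  Normc.normc (weyl_sum theta t (k ^ 16)) ^+ 2 <= 35 * k%:R ^+ 28.
Proof.
move=> k0 /andP[q1 q2] sep; set x : R := k%:R.
have x1 : 1 <= x by rewrite ler1n.
have x0 : 0 < x by rewrite ltr0n.
have q0 : (0 < q)%N by rewrite (leq_ltn_trans _ q1).
(* The threshold [k^-12] makes the geometric bound [2 k^12], and the count of exceptional shifts is
   also [O(k^12)] because both [k^16 / q] and [k^-12 q] are at most [k^12]. *)
have d0 : 0 < x ^- 12 by rewrite invr_gt0 exprn_gt0.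
have cnt := count_near_integer (k ^ 16) q0 (ltW d0) sep.
apply: le_trans (weyl_sum_sqr_le theta t (k ^ 16) d0) _.
set m := (count _ _)%:R in cnt *.
have mle : m <= 15 * x ^+ 12.
  apply: le_trans cnt _; rewrite natrX -/x.
  have qx : x ^+ 4 <= q%:R by rewrite -natrX ler_nat ltnW.
  have qx' : q%:R <= x ^+ 24 by rewrite -natrX ler_nat.
  have q0R : 0 < q%:R :> R by rewrite ltr0n.
  have h1 : x ^+ 16 / q%:R <= x ^+ 12.
    by rewrite ler_pdivrMr// (_ : 16 = 12 + 4)%N// exprD ler_wpM2l// exprn_ge0// ltW.
  have h2 : x ^- 12 * q%:R <= x ^+ 12.
    by rewrite mulrC ler_pdivrMr ?exprn_gt0// -exprD.
  have h3 : x ^- 12 * x ^+ 16 <= x ^+ 12.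
    by rewrite mulrC ler_pdivrMr ?exprn_gt0// -exprD ler_weXn2l.
  have h4 : 1 <= x ^+ 12 by rewrite exprn_ege1.
  have -> : (2 * x ^+ 16 / q%:R + 1) * (4 * x ^- 12 * q%:R + 1) =
     8 * (x ^- 12 * x ^+ 16) * (q%:R / q%:R) + 2 * (x ^+ 16 / q%:R)
     + 4 * (x ^- 12 * q%:R) + 1 by ring.
  by rewrite divff ?gt_eqF// mulr1; lra.
rewrite natrX -/x invrK.
have -> : 35 * x ^+ 28 = x ^+ 28 + 2 * (x ^+ 16 * (15 * x ^+ 12) + x ^+ 16 * (2 * x ^+ 12)).
  ring.
have h5 : x ^+ 16 <= x ^+ 28 by rewrite ler_weXn2l.
have h6 : x ^+ 16 * m <= x ^+ 16 * (15 * x ^+ 12) by rewrite ler_wpM2l// exprn_ge0// ltW.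
lra.
Qed.

(** Each unit shift of the window drops one term and adds one. *)
Lemma normc_shift_sum_le (u : nat -> R[i]) N s :
  (forall n, Normc.normc (u n) <= 1) ->
  Normc.normc (\sum_(0 <= n < N) u n - \sum_(0 <= n < N) u (n + s)%N) <= 2 * s%:R.
Proof.
move=> u1; elim: s => [|s IH].
  by under [X in _ - X]eq_bigr do rewrite addn0; rewrite subrr Normc.normc0 mulr0.
have e : \sum_(0 <= n < N) u (n + s.+1)%N = \sum_(0 <= n < N) u (n + s)%N + (u (N + s)%N - u s).
  apply/eqP; rewrite addrA -subr_eq opprK; apply/eqP.
  rewrite -(big_nat_recr _ _ (fun n => u (n + s)%N))//= big_nat_recl//= add0n addrC.
  by congr (_ + _); apply: eq_bigr => n _; rewrite addnS.
rewrite e opprD addrA; apply: le_trans (normcB_le _ _) _.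
rewrite -(natr1 s) mulrDr mulr1 lerD//; apply: le_trans (normcB_le _ _) _.
by rewrite (_ : 2 = 1 + 1)// lerD.
Qed.

(** Average over [K] shifts by multiples of [2q]. Along [n + 2 q j] the phase is, modulo integers,
    linear in [j] up to the small term [2 q j^2 r]; the slope stays [h] away from integers, so the
    inner sum is geometric up to that error. The last term of the bound pays for shifting the
    window. *)
Lemma weyl_sum_major_le theta t N K q (p : int) h g : 0 < h ->
  `|q%:R * (2 * t) - p%:~R| <= g ->
  (forall n, (0 < n <= N)%N ->
     int_dist_ge h (2 * q%:R * theta + 2 * n%:R * (q%:R * (2 * t) - p%:~R))) ->
  K%:R * Normc.normc (weyl_sum theta t N) <=
    N%:R * (2 / h + 32 * K%:R ^+ 3 * q%:R * g) + 4 * q%:R * K%:R ^+ 2.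
Proof.
move=> h0 hg hdist; set r := q%:R * (2 * t) - p%:~R in hg hdist.
have g0 : 0 <= g by exact: le_trans (normr_ge0 _) hg.
rewrite /weyl_sum big_add1 /=.
set u := fun n : nat => e1 (n.+1%:R * theta + (n.+1 ^ 2)%:R * t).
have u1 n : Normc.normc (u n) <= 1 by rewrite normc_e1.
have block n : (n < N)%N ->
    Normc.normc (\sum_(0 <= j < K) u (n + 2 * q * j)%N) <=
    2 / h + 32 * K%:R ^+ 3 * q%:R * g.
  move=> nN; pose al := 2 * q%:R * theta + 2 * n.+1%:R * r.
  (* The step is [2q] and not [q] so that the quadratic term contributes the integer [2 q j^2 p];
     with step [q] it could be a half-integer. *)
  have uE j : u (n + 2 * q * j)%N = u n * e1 (j%:R * al + 2 * q%:R * j%:R ^+ 2 * r).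
    have eN : (n + 2 * q * j).+1%:R = n.+1%:R + 2 * q%:R * j%:R :> R.
      by rewrite -addSn natrD !natrM.
    have eZ : (2 * (n.+1%:Z + q%:Z * j%:Z) * j%:Z * p)%:~R =
        2 * (n.+1%:R + q%:R * j%:R) * j%:R * p%:~R :> R.
      by rewrite !(intrM, intrD).
    rewrite -[RHS]mulr1 -(e1_int (2 * (n.+1%:Z + q%:Z * j%:Z) * j%:Z * p)).
    by rewrite -!e1D; congr e1; rewrite eZ /al /r !natrX eN; ring.
  under eq_bigr do rewrite uE; rewrite -big_distrr /= Normc.normcM normc_e1 mul1r.
  have -> : \sum_(0 <= j < K) e1 (j%:R * al + 2 * q%:R * j%:R ^+ 2 * r) =
     \sum_(0 <= j < K) e1 (j%:R * al) +
     \sum_(0 <= j < K) (e1 (j%:R * al + 2 * q%:R * j%:R ^+ 2 * r) - e1 (j%:R * al)).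
    by rewrite -big_split /=; apply: eq_bigr => j _; rewrite addrC subrK.
  apply: le_trans (normcD_le _ _) _; apply: lerD.
    by apply: geometric_e1_le => //; exact: hdist.
  apply: le_trans (normc_sum _ _ _) _.
  have -> : 32 * K%:R ^+ 3 * q%:R * g = \sum_(0 <= j < K) (32 * K%:R ^+ 2 * q%:R * g).
    by rewrite sumr_const_nat subn0 -mulr_natl; ring.
  apply: ler_sum_nat => j /andP[_ jK]; apply: le_trans (normc_e1_subr_le _ _) _.
  rewrite addrAC subrr add0r normrM ger0_norm ?mulr_ge0 ?exprn_ge0//.
  have jKR : j%:R ^+ 2 <= K%:R ^+ 2 :> R by rewrite -!natrX ler_nat leq_exp2r// ltnW.
  have -> : 32 * K%:R ^+ 2 * q%:R * g = 16 * (2 * q%:R * K%:R ^+ 2 * g) by ring.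
  rewrite ler_wpM2l// ler_pM// ?mulr_ge0 ?exprn_ge0//.
  by rewrite ler_wpM2l// mulr_ge0.
have -> : K%:R * Normc.normc (\sum_(0 <= n < N) u n) =
    Normc.normc (\sum_(0 <= j < K) \sum_(0 <= n < N) u n).
  by rewrite sumr_const_nat subn0 -(mulr_natl (\sum_(0 <= n < N) u n)) Normc.normcM normc_nat.
have -> : \sum_(0 <= j < K) \sum_(0 <= n < N) u n =
    \sum_(0 <= n < N) \sum_(0 <= j < K) u (n + 2 * q * j)%N +
    \sum_(0 <= j < K) (\sum_(0 <= n < N) u n - \sum_(0 <= n < N) u (n + 2 * q * j)%N).
  rewrite [X in _ = X + _]exchange_big_nat /= -big_split /=.
  by apply: eq_bigr => j _; rewrite addrC subrK.
apply: le_trans (normcD_le _ _) _; apply: lerD.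
  apply: le_trans (normc_sum _ _ _) _.
  apply: (@le_trans _ _ (\sum_(0 <= n < N) (2 / h + 32 * K%:R ^+ 3 * q%:R * g))).
    by apply: ler_sum_nat => n /andP[_ nN]; exact: block.
  by rewrite sumr_const_nat subn0 -[leLHS]mulr_natl.
apply: le_trans (normc_sum _ _ _) _.
apply: (@le_trans _ _ (\sum_(0 <= j < K) 4 * q%:R * K%:R)).
  apply: ler_sum_nat => j /andP[_ jK]; apply: le_trans (normc_shift_sum_le _ _ u1) _.
  have : j%:R <= K%:R :> R by rewrite ler_nat ltnW.
  rewrite !natrM => /(ler_wpM2l (ler0n R q)); lra.
by rewrite sumr_const_nat subn0 -[leLHS]mulr_natl expr2; lra.
Qed.

(** The hypothesis concerns reduced fractions only. Dividing [p] and [q] by their gcd [g] gives the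
    bound for [q' = q / g], and multiplying back by [g] only improves it. *)
Lemma badly_approximable_int_dist_ge c theta q : 0 <= c ->
  badly_approximable c theta -> (0 < q)%N -> int_dist_ge (c / q%:R) (q%:R * theta).
Proof.
move=> c0 bad q0 p.
pose g := gcdn `|p| q; pose p' := Num.sg p * (`|p| %/ g)%N%:Z; pose q' := (q %/ g)%N.
have g0 : (0 < g)%N by rewrite gcdn_gt0 q0 orbT.
have q'0 : (0 < q')%N by rewrite divn_gt0// dvdn_leq// dvdn_gcdr.
have qE : q = (q' * g)%N by rewrite divnK// dvdn_gcdr.
have pE : p = p' * g%:Z.
  by rewrite -mulrA -PoszM divnK ?dvdn_gcdl// abszE -numEsg.
have cop : coprime `|p'| q'.
  have [p0|p0] := eqVneq p 0.
    by rewrite /p' /q' /g p0 gcd0n divnn q0 coprimen1.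
  rewrite /p' abszM absz_sg p0 mul1n /coprime /q'.
  by rewrite -(eqn_pmul2r g0) muln_gcdl !divnK ?dvdn_gcdl ?dvdn_gcdr// mul1n.
have := bad p' q' q'0 cop.
have q'R : 0 < q'%:R :> R by rewrite ltr0n.
have gR : 1 <= g%:R :> R by rewrite ler1n.
move=> H; have h1 : c / q'%:R <= `|q'%:R * theta - p'%:~R|.
  have -> : q'%:R * theta - p'%:~R = q'%:R * (theta - p'%:~R / q'%:R).
    by field; rewrite gt_eqF.
  rewrite normrM normr_nat [leRHS]mulrC -ler_pdivrMr//.
  by rewrite -mulrA -invfM -expr2.
have -> : q%:R * theta - p%:~R = g%:R * (q'%:R * theta - p'%:~R).
  by rewrite {1}qE {1}pE natrM rmorphM /=; ring.
rewrite normrM normr_nat; apply: le_trans (_ : c / q'%:R <= _).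
  by rewrite ler_wpM2l// lef_pV2 ?posrE ?ltr0n// ler_nat [X in (_ <= X)%N]qE leq_pmulr.
by apply: le_trans h1 _; rewrite ler_peMl.
Qed.

(** The summands serve the three cases of [weyl_sum_bound]: large denominator, small [k], and small
    denominator. *)
Definition weyl_const c : R := 35 + 8 / c + (8 / c + 36) ^+ 2.

Lemma weyl_sum_bound c theta t k : 0 < c -> badly_approximable c theta ->
  (0 < k)%N ->
  Normc.normc (weyl_sum theta t (k ^ 16)) ^+ 2 <= weyl_const c * k%:R ^+ 28.
Proof.
move=> c0 bad k0; set x : R := k%:R.
have x1 : 1 <= x by rewrite ler1n.
have x0 : 0 < x by rewrite ltr0n.
have xX n : 0 < x ^+ n by rewrite exprn_gt0.
have c8 : 0 <= 8 / c by rewrite divr_ge0// ltW.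
have sq0 : 0 <= (8 / c + 36) ^+ 2 by exact: sqr_ge0.
have k24 : (0 < k ^ 24)%N by rewrite expn_gt0 k0.
have [q [/andP[q0 qQ] [p hp] sep]] := dirichlet_minimal (2 * t) k24.
have [qk|qk] := ltnP (k ^ 4) q.
  apply: le_trans (weyl_sum_minor theta k0 _ sep) _; first by rewrite qk.
  by rewrite ler_wpM2r ?(ltW (xX _))// /weyl_const; lra.
(* For such small [k] the trivial bound [k^32 = k^4 k^28] suffices. *)
have [kc|kc] := ltP (x ^+ 4) (8 / c).
  have : Normc.normc (weyl_sum theta t (k ^ 16)) ^+ 2 <= x ^+ 32.
    rewrite (_ : 32 = 16 * 2)%N// exprM ler_pXn2r ?nnegrE ?normc_ge0 ?(ltW (xX _))//.
    by rewrite -natrX weyl_sum_le_size.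
  move=> /le_trans; apply; rewrite (_ : 32 = 4 + 28)%N// exprD.
  by rewrite ler_wpM2r ?(ltW (xX _))// /weyl_const; lra.
have q0R : 0 < q%:R :> R by rewrite ltr0n.
have qx : q%:R <= x ^+ 4 by rewrite -natrX ler_nat.
(* The slope [2 q theta] is at least [c / (2 k^4)] away from integers, and the drift
   [2 n r <= 2 k^-8] uses up at most half of this because [k^4 >= 8 / c]. *)
have h0 : 0 < c / (4 * x ^+ 4) by rewrite divr_gt0// mulr_gt0.
have hd n : (0 < n <= k ^ 16)%N -> int_dist_ge (c / (4 * x ^+ 4))
    (2 * q%:R * theta + 2 * n%:R * (q%:R * (2 * t) - p%:~R)).
  move=> /andP[_ nk] b; set r := q%:R * (2 * t) - p%:~R in hp *.
  have q20 : (0 < 2 * q)%N by rewrite muln_gt0.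
  have := badly_approximable_int_dist_ge (ltW c0) bad q20 b.
  rewrite natrM; set y := 2%:R * q%:R * theta - b%:~R => hy.
  have -> : 2 * q%:R * theta + 2 * n%:R * r - b%:~R = y + 2 * n%:R * r.
    by rewrite /y; ring.
  have h1 : c / (2 * x ^+ 4) <= `|y|.
    apply: le_trans hy; rewrite ler_wpM2l ?(ltW c0)// lef_pV2 ?posrE ?mulr_gt0//.
    by rewrite ler_wpM2l.
  have h2 : `|2 * n%:R * r| <= c / (4 * x ^+ 4).
    rewrite normrM ger0_norm ?mulr_ge0//.
    apply: (@le_trans _ _ (2 * x ^+ 16 * x ^- 24)).
      rewrite ler_pM ?mulr_ge0//; last by rewrite -natrX.
      by rewrite ler_wpM2l// -natrX ler_nat.
    rewrite ler_pdivlMr ?mulr_gt0//.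
    have -> : 2 * x ^+ 16 * x ^- 24 * (4 * x ^+ 4) = 8 * x ^- 4.
      by field; rewrite gt_eqF.
    by rewrite ler_pdivrMr// mulrC -ler_pdivrMr.
  have -> : c / (4 * x ^+ 4) = c / (2 * x ^+ 4) - c / (4 * x ^+ 4).
    by field; rewrite gt_eqF.
  apply: le_trans (lerB h1 h2) _; rewrite -(normrN (2 * _ * r)).
  by apply: le_trans (lerB_dist _ _) _; rewrite opprK.
(* With [K = k^6] the right-hand side is at most [(8/c) k^20 + 32 k^14 + 4 k^16]; division by [K]
   leaves [O(k^14)], the square root of the target. *)
have := weyl_sum_major_le (k ^ 6) h0 hp hd.
rewrite !natrX -/x; set S := Normc.normc _ => hS.
have S0 : 0 <= S by exact: normc_ge0.
suff Sle : S <= (8 / c + 36) * x ^+ 14.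
  apply: le_trans (_ : ((8 / c + 36) * x ^+ 14) ^+ 2 <= _).
    by rewrite ler_pXn2r ?nnegrE// mulr_ge0// ?addr_ge0// ltW.
  by rewrite exprMn -exprM ler_wpM2r ?(ltW (xX _))// /weyl_const; lra.
rewrite -(ler_pM2l (xX 6)); apply: le_trans hS _.
have e1' : x ^+ 16 * (2 / (c / (4 * x ^+ 4))) = 8 / c * x ^+ 20.
  by field; rewrite !gt_eqF.
have e2' : x ^+ 16 * (32 * (x ^+ 6) ^+ 3 * x ^+ 4 * x ^- 24) = 32 * x ^+ 14.
  by field; rewrite gt_eqF.
have l1 : x ^+ 16 * (32 * (x ^+ 6) ^+ 3 * q%:R * x ^- 24)
    <= x ^+ 16 * (32 * (x ^+ 6) ^+ 3 * x ^+ 4 * x ^- 24).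
  rewrite ler_wpM2l ?(ltW (xX _))// ler_wpM2r ?invr_ge0 ?(ltW (xX _))//.
  by rewrite ler_wpM2l// mulr_ge0// exprn_ge0// ltW.
have l2 : 4 * q%:R * (x ^+ 6) ^+ 2 <= 4 * x ^+ 4 * (x ^+ 6) ^+ 2.
  by rewrite ler_wpM2r ?exprn_ge0 ?(ltW (xX _))// ler_wpM2l.
have e3' : 4 * x ^+ 4 * (x ^+ 6) ^+ 2 = 4 * x ^+ 16 by ring.
have e4' : x ^+ 6 * ((8 / c + 36) * x ^+ 14) = 8 / c * x ^+ 20 + 36 * x ^+ 20 by ring.
have l3 : x ^+ 14 <= x ^+ 20 by rewrite ler_weXn2l.
have l4 : x ^+ 16 <= x ^+ 20 by rewrite ler_weXn2l.
rewrite mulrDr e1' e4'; lra.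
Qed.

End WeylSum.

(** * Fourier analysis on the integers modulo [L], and transference *)

Section FiniteFourier.
Context {R : realType}.
Context (L : nat) (L0 : (0 < L)%N).

Lemma e1_orthogonality i j : (i < L)%N -> (j < L)%N ->
  \sum_(0 <= k < L) e1 (k%:R * ((i%:R - j%:R) / L%:R)) = (L * (i == j))%:R :> R[i].
Proof.
move=> iL jL; have L0R : 0 < L%:R :> R by rewrite ltr0n.
have [->|ij] := eqVneq i j.
  under eq_bigr do rewrite subrr mul0r mulr0 e10.
  by rewrite sumr_const_nat subn0 muln1.
rewrite muln0; set a : R := _ / _.
have La : L%:R * a = (i%:Z - j%:Z)%:~R by rewrite /a mulrC divfK ?gt_eqF// intrB.
(* [L a = i - j] is a nonzero integer of modulus below [L], so it is no multiple of [L]. Thus [e1 a]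
   is a root of unity other than 1 and the geometric sum vanishes. *)
have hd : int_dist_ge L%:R^-1 a.
  move=> p; rewrite -(ler_pM2l L0R) mulfV ?gt_eqF//.
  rewrite -[X in X * _]normr_nat -normrM mulrBr La.
  have -> : (i%:Z - j%:Z)%:~R - L%:R * p%:~R = (i%:Z - j%:Z - L%:Z * p)%:~R :> R.
    by rewrite !(intrB, intrM).
  rewrite -intr_norm -[1]/(1%:~R) ler_int.
  suff : i%:Z - j%:Z - L%:Z * p != 0 by lia.
  apply/eqP => e; move/eqP: ij; apply.
  have : (`|i%:Z - j%:Z| < L%:Z)%R by lia.
  have -> : i%:Z - j%:Z = L%:Z * p by lia.
  have [p0|p0] := eqVneq p 0; first by move: e; rewrite p0 mulr0; lia.
  have p1 : 1 <= `|p| by lia.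
  by rewrite normrM; nia.
have nz : 1 - e1 a != 0.
  have := normc_1_sub_e1_ge hd; apply: contraTneq => ->.
  by rewrite Normc.normc0 -ltNge invr_gt0.
by apply: (mulIf nz); rewrite geometric_e1 La e1_int subrr mul0r.
Qed.

Lemma parseval (v : nat -> R[i]) :
  \sum_(0 <= j < L) Normc.normc (\sum_(0 <= k < L) v k * e1 (j%:R * (k%:R / L%:R))) ^+ 2
  = L%:R * \sum_(0 <= k < L) Normc.normc (v k) ^+ 2.
Proof.
apply: complexI; rewrite sum_real_complex mul_real_complex sum_real_complex nat_real_complex.
under eq_bigr do rewrite sqr_normcE conjc_sum mulr_suml.
rewrite mulr_sumr.
rewrite exchange_big_nat; apply: eq_big_nat => k /andP[_ kL].
under eq_bigr do rewrite mulr_sumr.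
rewrite exchange_big_nat.
have E i : \sum_(0 <= j < L) v k * e1 (j%:R * (k%:R / L%:R)) *
     conjc (v i * e1 (j%:R * (i%:R / L%:R))) =
   v k * conjc (v i) * \sum_(0 <= j < L) e1 (j%:R * ((k%:R - i%:R) / L%:R)).
  rewrite mulr_sumr; apply: eq_bigr => j _.
  by rewrite conjc_mul -e1N mulrACA -e1D -mulrN -mulrDr mulrBl.
rewrite (eq_big_nat _ _ (F2 := fun i => if i == k then L%:R * (v k * conjc (v k)) else 0)).
  by rewrite -big_mkcond /= big_nat1_eq /= kL sqr_normcE.
move=> i /andP[_ iL]; rewrite E e1_orthogonality// eq_sym.
by case: eqP => [->|_]; rewrite ?muln1 ?muln0 ?mulr0// mulrC.
Qed.

Lemma fourier_inversion (phi : nat -> R[i]) j : (j < L)%N ->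
  \sum_(0 <= k < L) (\sum_(0 <= i < L) phi i * e1 (- (k%:R * (i%:R / L%:R)))) *
    e1 (j%:R * (k%:R / L%:R)) = L%:R * phi j.
Proof.
move=> jL; under eq_bigr do rewrite mulr_suml.
rewrite exchange_big_nat.
rewrite (eq_big_nat _ _ (F2 := fun i => if i == j then L%:R * phi j else 0)).
  by rewrite -big_mkcond /= big_nat1_eq /= jL.
move=> i /andP[_ iL].
have -> : \sum_(0 <= k < L) phi i * e1 (- (k%:R * (i%:R / L%:R))) * e1 (j%:R * (k%:R / L%:R)) =
   phi i * \sum_(0 <= k < L) e1 (k%:R * ((j%:R - i%:R) / L%:R)).
  rewrite mulr_sumr; apply: eq_bigr => k _.
  by rewrite -mulrA -e1D; congr (_ * e1 _); ring.
rewrite e1_orthogonality// eq_sym.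
by case: eqP => [->|_]; rewrite ?muln1 ?muln0 ?mulr0// mulrC.
Qed.

End FiniteFourier.

(* A finite substitute for the spectral theorem: no wrap-around occurs because
   all indices [m + s n] with [m < M] stay below [M + D]. *)
Lemma transference {R : realType} (r : seq nat) (a : nat -> R[i]) (s : nat -> nat)
    (B : R) (M D : nat) (phi : nat -> R[i]) :
  (0 < M)%N -> {in r, forall n, (s n <= D)%N} ->
  (forall t : R, Normc.normc (\sum_(n <- r) a n * e1 ((s n)%:R * t)) ^+ 2 <= B) ->
  \sum_(0 <= m < M) Normc.normc (\sum_(n <- r) a n * phi (m + s n)%N) ^+ 2 <=
    B * \sum_(0 <= j < M + D) Normc.normc (phi j) ^+ 2.
Proof.
move=> M0 sD hB; set L := (M + D)%N; have L0 : (0 < L)%N by rewrite ltn_addr.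
have L0R : 0 < L%:R :> R by rewrite ltr0n.
pose phih k := \sum_(0 <= i < L) phi i * e1 (- (k%:R * (i%:R / L%:R))).
pose P t := \sum_(n <- r) a n * e1 ((s n)%:R * t).
(* On the Fourier side the weighted sum of translates is multiplication by [P], which is bounded
   pointwise by [hB]. *)
have key m : (m < M)%N -> L%:R * \sum_(n <- r) a n * phi (m + s n)%N =
    \sum_(0 <= k < L) (phih k * P (k%:R / L%:R)) * e1 (m%:R * (k%:R / L%:R)).
  move=> mM; rewrite mulr_sumr.
  transitivity (\sum_(n <- r) \sum_(0 <= k < L)
     a n * (phih k * e1 ((m + s n)%:R * (k%:R / L%:R)))).
    rewrite big_seq [RHS]big_seq; apply: eq_bigr => n nr.
    rewrite mulrCA -fourier_inversion ?mulr_sumr//.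
    by have := sD n nr; rewrite /L; lia.
  rewrite exchange_big /=; apply: eq_bigr => k _.
  rewrite /P mulr_sumr mulr_suml; apply: eq_bigr => n _.
  rewrite natrD mulrDl e1D; ring.
have phihE k : Normc.normc (phih k) =
    Normc.normc (\sum_(0 <= i < L) conjc (phi i) * e1 (k%:R * (i%:R / L%:R))).
  rewrite -normc_conj conjc_sum; congr Normc.normc; apply: eq_bigr => i _.
  by rewrite conjc_mul e1N conjcK.
have B0 : 0 <= B by exact: le_trans (sqr_ge0 _) (hB 0).
rewrite -(ler_pM2l (exprn_gt0 2 L0R)) mulr_sumr.
apply: (@le_trans _ _ (\sum_(0 <= m < L) Normc.normc (\sum_(0 <= k < L)
     (phih k * P (k%:R / L%:R)) * e1 (m%:R * (k%:R / L%:R))) ^+ 2)).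
  rewrite [leRHS](@big_cat_nat _ _ _ M)//=; last by rewrite /L leq_addr.
  apply: ler_wpDr; first by apply: sumr_ge0 => m _; rewrite sqr_ge0.
  apply: ler_sum_nat => m /andP[_ mM].
  by rewrite -key// Normc.normcM normc_nat exprMn.
rewrite parseval// expr2 -mulrA ler_pM2l//.
apply: (@le_trans _ _ (\sum_(0 <= k < L) B * Normc.normc (phih k) ^+ 2)).
  apply: ler_sum => k _; rewrite Normc.normcM exprMn [leLHS]mulrC.
  by apply: ler_wpM2r; [exact: sqr_ge0|exact: hB].
rewrite -mulr_sumr mulrCA ler_wpM2l//.
under eq_bigr do rewrite phihE.
rewrite parseval// ler_pM2l//.
by apply: ler_sum => k _; rewrite normc_conj.
Qed.

(** * Finite nets from the Minkowski dimension *)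

Section FiniteNets.
Context {R : realType}.
Implicit Types E : set R.

Lemma interval_cover_unit E (eps : R) : E `<=` `[0, 1]%classic -> 0 < eps ->
  exists n, interval_cover E eps n.
Proof.
move=> E01 eps0; exists (Num.truncn eps^-1).+1.
exists (fun i => i%:R * eps) => x Ex; have := E01 _ Ex; rewrite /= in_itv /= => /andP[x0 x1].
have xe0 : 0 <= x / eps by rewrite divr_ge0// ltW.
have lt : (Num.truncn (x / eps) < (Num.truncn eps^-1).+1)%N.
  by rewrite ltnS le_truncn// ler_piMl// invr_ge0 ltW.
exists (Ordinal lt) => //=; rewrite in_itv /=.
have /andP[h1 h2] := truncn_itv xe0.
move: h1 h2; rewrite ler_pdivlMr// ltr_pdivrMr// -(natr1 (Num.truncn _)) mulrDl mul1r.
by move=> -> /ltW ->.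
Qed.

Lemma covering_number_cover E (eps : R) : E `<=` `[0, 1]%classic -> 0 < eps ->
  interval_cover E eps (covering_number E eps).
Proof.
move=> E01 eps0; have [n0 n0P] := interval_cover_unit E01 eps0.
have ex : exists n, `[< interval_cover E eps n >] by exists n0; apply/asboolP.
case: (ex_minnP ex) => n /asboolP nP nmin.
rewrite /covering_number; set A := [set _ | _].
suff : A (xget 0%N A) by case.
apply: (@xgetPex _ _ A); exists n; split => // m mP.
by apply: nmin; apply/asboolP.
Qed.

(** One point of [E] is picked from each covering interval that meets [E]; net points in [E] itself
    are badly approximable. *)
Lemma covering_number_net E (eps : R) : E `<=` `[0, 1]%classic -> 0 < eps ->
  exists s : seq R, [/\ {in s, forall x, E x}, (size s <= covering_number E eps)%N &
    forall x, E x -> exists2 y, y \in s & `|x - y| <= eps].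
Proof.
move=> E01 eps0; have [a aP] := covering_number_cover E01 eps0.
set n := covering_number E eps in a aP *.
pose I (i : 'I_n) : set R := E `&` `[a i, a i + eps]%classic.
exists [seq xget 0 (I i) | i <- enum 'I_n & `[< I i !=set0 >]]; split.
- move=> x xs; have [j + ->] := mapP xs; rewrite mem_filter => /andP[/asboolP [y Iy] _].
  by have [] := xgetI 0 Iy.
- by rewrite size_map size_filter (leq_trans (count_size _ _))// size_enum_ord.
- move=> x Ex; have [i _ xi] := aP _ Ex.
  have Ix : I i x by [].
  exists (xget 0 (I i)).
    by apply: map_f; rewrite mem_filter mem_enum andbT; apply/asboolP; exists x.
  have [_] := xgetI 0 Ix; move: xi; rewrite /= !in_itv /= => /andP[? ?] /andP[? ?].
  by rewrite ler_norml; apply/andP; split; lra.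
Qed.

Lemma covering_number_eventually_le E :
  (upper_minkowski_dim E < (1 / 16 : R)%:E)%E ->
  exists k0, forall k, (k0 <= k)%N -> (covering_number E (k%:R ^- 32) <= k ^ 2)%N.
Proof.
rewrite /upper_minkowski_dim /limf_esup => /ereal_inf_lt[_ [V V0 <-] supV].
move/nbhs_ballP : V0 => [e /= e0 He]; exists (Num.truncn e^-1 + 2)%N => k k0.
(* The summand 2 in the threshold gives both [ln k > 0] and [k > 1/e], so that [k^-32] lies in the
   neighbourhood [V]. *)
have k1 : (1 < k)%N by lia.
have kR : 1 < k%:R :> R by rewrite ltr1n.
have kR0 : 0 < k%:R :> R by rewrite ltr0n ltnW.
set eps := k%:R ^- 32.
have eps0 : 0 < eps by rewrite invr_gt0 exprn_gt0.
have epslt : eps < e.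
  rewrite /eps -[ltRHS]invrK ltf_pV2 ?posrE ?invr_gt0 ?exprn_gt0//.
  apply: lt_le_trans (_ : k%:R <= _).
    apply: lt_le_trans (truncnS_gt _) _.
    by rewrite ler_nat (leq_trans _ k0)// addn2.
  by rewrite -[leLHS]expr1 ler_weXn2l// ltW.
have Veps : V eps.
  by apply: He => //=; rewrite /ball /= sub0r normrN gtr0_norm.
have : (((ln (covering_number E eps)%:R : R) / ln (1 / eps))%:E < (1 / 16 : R)%:E)%E.
  by apply: le_lt_trans supV; apply: ereal_sup_ubound; exists eps.
rewrite lte_fin div1r /eps invrK lnXn// -/eps.
have lnk : 0 < ln k%:R :> R by rewrite ln_gt0.
rewrite ltr_pdivrMr ?mulrn_wgt0// => h.
(* An empty cover is treated apart, since the comparison of logarithms needs a positive argument.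
   Otherwise [ln] of the covering number is below [(32/16) ln k = ln (k^2)]. *)
have [->//|N0] := posnP (covering_number E eps).
rewrite ltnW// -(ltr_nat R) natrX -ltr_ln ?posrE ?ltr0n ?exprn_gt0//.
rewrite lnXn//; move: h; rewrite -[_ *+ 32]mulr_natl -[_ *+ 2]mulr_natl; lra.
Qed.

Lemma minkowski_nets E : E `<=` `[0, 1]%classic ->
  (upper_minkowski_dim E < (1 / 16 : R)%:E)%E ->
  exists (net : nat -> seq R) (k0 : nat),
  [/\ (0 < k0)%N, forall k, {in net k, forall x, E x},
      forall k, (size (net k) <= k ^ 2)%N &
      forall k, (k0 <= k)%N -> forall x, E x ->
        exists2 y, y \in net k & `|x - y| <= k%:R ^- 32].
Proof.
move=> E01 /covering_number_eventually_le[k0 hk0].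
have H k : exists s : seq R, [/\ {in s, forall x, E x}, (size s <= k ^ 2)%N &
   (k0.+1 <= k)%N -> forall x, E x -> exists2 y, y \in s & `|x - y| <= k%:R ^- 32].
  (* The empty net for small [k] keeps membership and size bounds valid for every [k]. *)
  have [kk|kk] := ltnP k0 k; last by exists [::].
  have kp : 0 < (k%:R : R) ^- 32.
    by rewrite invr_gt0 exprn_gt0// ltr0n (leq_ltn_trans _ kk).
  have [s [sE sz sP]] := covering_number_net E01 kp.
  by exists s; split => //; rewrite (leq_trans sz)// hk0// ltnW.
have [net netP] := choice H; exists net, k0.+1; split => // k.
- by have [] := netP k.
- by have [] := netP k.
- by have [] := netP k.
Qed.

End FiniteNets.

(** * Transference to the dynamical system and almost everywhere convergence *)

Section Dynamics.
Context d (X : measurableType d) (R : realType).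
Context (mu : probability X R) (T : X -> X) (T_mp : measure_preserving mu T).

Lemma measurable_iter n : measurable_fun setT (iter n T).
Proof.
elim: n => [|n IH]; first exact: measurable_id.
by apply: (measurableT_comp _ IH); case: T_mp.
Qed.

Lemma integral_iter n (g : X -> \bar R) : measurable_fun setT g ->
  (forall x, (0 <= g x)%E) ->
  (\int[mu]_x g (iter n T x) = \int[mu]_x g x)%E.
Proof.
move=> mg g0; elim: n => [//|n IH]; rewrite -[RHS]IH.
have [mT T_pres] := T_mp.
have mgn : measurable_fun setT (fun x => g (iter n T x)).
  exact: measurableT_comp mg (measurable_iter n).
transitivity (\int[pushforward mu T]_x g (iter n T x))%E.
  rewrite ge0_integral_pushforward//.
  by apply: eq_integral => x _ /=; rewrite -iterSr.
by apply: eq_measure_integral => A mA _; exact: T_pres.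
Qed.

Definition complex_measurable (f : X -> R[i]) :=
  measurable_fun setT (fun x => complex.Re (f x)) /\
  measurable_fun setT (fun x => complex.Im (f x)).

Lemma complex_measurable_iter n f : complex_measurable f ->
  complex_measurable (fun x => f (iter n T x)).
Proof.
by case=> mRe mIm; split;
  [exact: (measurableT_comp mRe (measurable_iter n))|
   exact: (measurableT_comp mIm (measurable_iter n))].
Qed.

Lemma complex_measurableZ a f : complex_measurable f ->
  complex_measurable (fun x => a * f x).
Proof.
case: a => a b [mRe mIm]; split.
- rewrite (_ : (fun _ => _) = (fun x => a * complex.Re (f x) - b * complex.Im (f x))).
    by apply: measurable_funB; apply: measurable_funM => //; exact: measurable_cst.
  by apply/funext => x; case: (f x).
- rewrite (_ : (fun _ => _) = (fun x => a * complex.Im (f x) + b * complex.Re (f x))).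
    by apply: measurable_funD; apply: measurable_funM => //; exact: measurable_cst.
  by apply/funext => x; case: (f x).
Qed.

Lemma complex_measurable_sum (I : Type) (r : seq I) (f : I -> X -> R[i]) :
  (forall j, complex_measurable (f j)) ->
  complex_measurable (fun x => \sum_(j <- r) f j x).
Proof.
move=> mf; split.
- rewrite (_ : (fun _ => _) = (fun x => \sum_(j <- r) complex.Re (f j x))).
    by apply: measurable_sum => j; case: (mf j).
  by apply/funext => x; exact: Re_sum.
- rewrite (_ : (fun _ => _) = (fun x => \sum_(j <- r) complex.Im (f j x))).
    by apply: measurable_sum => j; case: (mf j).
  by apply/funext => x; exact: Im_sum.
Qed.

Lemma measurable_sqr_normc f : complex_measurable f ->
  measurable_fun setT (fun x => Normc.normc (f x) ^+ 2).
Proof.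
case=> mRe mIm; under eq_fun do rewrite sqr_normc.
by apply: measurable_funD; under eq_fun do rewrite expr2; exact: measurable_funM.
Qed.

(** Apply [transference] to each orbit segment and integrate; invariance of the measure makes every
    summand on a side have the same integral. *)
Lemma integral_transference (f : X -> R[i]) (r : seq nat) (a : nat -> R[i])
    (s : nat -> nat) (B : R) : complex_measurable f ->
  (forall t : R, Normc.normc (\sum_(n <- r) a n * e1 ((s n)%:R * t)) ^+ 2 <= B) ->
  (\int[mu]_x (Normc.normc (\sum_(n <- r) a n * f (iter (s n) T x)) ^+ 2)%:E <=
   (2 * B)%:E * \int[mu]_x (Normc.normc (f x) ^+ 2)%:E)%E.
Proof.
move=> mf hB; have B0 : 0 <= B by exact: le_trans (sqr_ge0 _) (hB 0).
(* This [M] gives [M + D <= 2 M], the source of the factor 2. *)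
set D := \max_(n <- r) s n; pose M := D.+1.
have sD : {in r, forall n, (s n <= D)%N} by move=> n nr; exact: leq_bigmax_seq.
pose G x := Normc.normc (\sum_(n <- r) a n * f (iter (s n) T x)) ^+ 2.
pose F x := Normc.normc (f x) ^+ 2.
have mF : measurable_fun setT F by exact: measurable_sqr_normc.
have mG : measurable_fun setT G.
  apply: measurable_sqr_normc; apply: complex_measurable_sum => n.
  by apply: complex_measurableZ; exact: complex_measurable_iter.
have F0 x : (0 <= (F x)%:E)%E by rewrite lee_fin sqr_ge0.
have G0 x : (0 <= (G x)%:E)%E by rewrite lee_fin sqr_ge0.
have mEF : measurable_fun setT (EFin \o F) by exact/measurable_EFinP.
have mEG : measurable_fun setT (EFin \o G) by exact/measurable_EFinP.
have mFi n : measurable_fun setT (fun x => (F (iter n T x))%:E).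
  exact: (measurableT_comp mEF (measurable_iter n)).
have mGi n : measurable_fun setT (fun x => (G (iter n T x))%:E).
  exact: (measurableT_comp mEG (measurable_iter n)).
have sumF (H : X -> R) n : measurable_fun setT (EFin \o H) -> (forall x, (0 <= (H x)%:E)%E) ->
    (\int[mu]_x (\sum_(0 <= j < n) (H (iter j T x))%:E) = n%:R%:E * \int[mu]_x (H x)%:E)%E.
  move=> mH H0; rewrite ge0_integral_sum//; last first.
    by move=> j; exact: (measurableT_comp mH (measurable_iter j)).
  under eq_bigr do rewrite (@integral_iter _ (EFin \o H))//.
  by rewrite sumr_const_nat subn0 mule_natl.
have pw x : ((\sum_(0 <= m < M) (G (iter m T x))%:E) <=
   B%:E * \sum_(0 <= j < M + D) (F (iter j T x))%:E)%E.
  rewrite !sumEFin -EFinM lee_fin.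
  have := @transference R r a s B M D (fun j => f (iter j T x)) isT sD hB.
  apply: le_trans; apply: ler_sum => m _; rewrite /G.
  by under [in leRHS]eq_bigr do rewrite addnC iterD.
have : (M%:R%:E * \int[mu]_x (G x)%:E <= M%:R%:E * ((2 * B)%:E * \int[mu]_x (F x)%:E))%E.
  rewrite -(sumF G)//.
  apply: (@le_trans _ _ (\int[mu]_x (B%:E * \sum_(0 <= j < M + D) (F (iter j T x))%:E))%E).
    apply: ge0_le_integral => //.
    - by move=> x _; apply: sume_ge0.
    - by apply: emeasurable_sum => m; exact: mGi.
    - apply: emeasurable_funM; first exact: measurable_cst.
      by apply: emeasurable_sum => m; exact: mFi.
  rewrite ge0_integralZl_EFin//; last 2 first.
    - by move=> x _; apply: sume_ge0.
    - by apply: emeasurable_sum => m; exact: mFi.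
  rewrite sumF// !muleA -!EFinM lee_wpmul2r//; first by apply: integral_ge0.
  rewrite lee_fin mulrC mulrCA mulrA ler_wpM2r// -natrM ler_nat /M; lia.
by rewrite lee_pmul2l// lte_fin ltr0n.
Qed.

(** The series of the [W k] has finite integral, so it is finite almost everywhere, and where it is
    finite its terms tend to 0. *)
Lemma ae_cvg0_of_summable (W : nat -> X -> R) (u : nat -> R) (C : R) :
  (forall k, measurable_fun setT (W k)) -> (forall k x, 0 <= W k x) ->
  (forall k, (\int[mu]_x (W k x)%:E <= (u k)%:E)%E) ->
  (forall n, \sum_(0 <= k < n) u k <= C) ->
  exists X' : set X, [/\ measurable X', mu X' = 1%E &
    forall x, X' x -> W ^~ x @ \oo --> (0 : R)].
Proof.
move=> mW W0 Wu uC.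
have mEW k : measurable_fun setT (fun x => (W k x)%:E) by exact/measurable_EFinP.
have EW0 k x : (0 <= (W k x)%:E)%E by rewrite lee_fin.
pose S x := (\sum_(0 <= k <oo) (W k x)%:E)%E.
have mS : measurable_fun setT S by exact: ge0_emeasurable_sum.
have S0 x : (0 <= S x)%E by apply: nneseries_ge0.
have intS : (\int[mu]_x S x <= C%:E)%E.
  rewrite integral_nneseries//; apply: lime_le.
    by apply: is_cvg_nneseries => k _ _; exact: integral_ge0.
  apply: nearW => n; apply: (@le_trans _ _ (\sum_(0 <= k < n) (u k)%:E)%E).
    by apply: lee_sum.
  by rewrite sumEFin lee_fin.
have iS : mu.-integrable setT S.
  apply/integrableP; split => //.
  under eq_integral do rewrite gee0_abs//.
  by apply: le_lt_trans intS _; exact: ltry.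
have mA : measurable [set x | S x \is a fin_num].
  by rewrite -[X in measurable X]setTI; exact: emeasurable_fin_num.
exists [set x | S x \is a fin_num]; split => //.
  have neg : mu (~` [set x | S x \is a fin_num]) = 0%E.
    apply: measure_negligible; first exact: measurableC.
    have := integrable_ae measurableT iS; rewrite /almost_everywhere.
    by apply: negligibleS => x /= h1 h2; apply: h1; exact: h2.
  by rewrite -[X in mu X]setCK probability_setC ?neg ?sube0//; exact: measurableC.
move=> x /= Sx.
have Slt : (S x < +oo)%E by rewrite ltey; move: Sx; case: (S x).
have tail := nneseries_tail_cvg Slt (fun k _ => EW0 k x).
have cvgE : (W n x)%:E @[n --> \oo] --> (0 : R)%:E.
  apply: (squeeze_cvge _ (cvg_cst _) tail).
  apply: nearW => n; rewrite EW0 /=.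
  have := @nneseries_lim_ge R (fun k => (W k x)%:E) xpredT n n.+1 (fun k _ _ => EW0 k x).
  by rewrite big_nat1.
exact: fine_cvg cvgE.
Qed.

End Dynamics.

(** * Elementary inequalities for powers and sums *)

Section Elementary.
Context {R : realType}.

Lemma exprn_succ_gap n : exists2 C : R, 0 <= C &
  forall x : R, 1 <= x -> (x + 1) ^+ n.+1 - x ^+ n.+1 <= C * x ^+ n.
Proof.
elim: n => [|n [C C0 IH]]; first by exists 1 => // x _; rewrite !expr1 expr0; lra.
exists (2 * C + 1) => [|x x1]; first by lra.
have x0 : 0 <= x by lra.
have xn0 : 0 <= x ^+ n by rewrite exprn_ge0.
have -> : (x + 1) ^+ n.+2 - x ^+ n.+2 =
    (x + 1) * ((x + 1) ^+ n.+1 - x ^+ n.+1) + x ^+ n.+1.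
  by rewrite [(x + 1) ^+ n.+2]exprS [x ^+ n.+2]exprS; ring.
have h1 : (x + 1) * ((x + 1) ^+ n.+1 - x ^+ n.+1) <= (x + 1) * (C * x ^+ n).
  by rewrite ler_wpM2l ?IH//; lra.
have h2 : C * x ^+ n <= C * x ^+ n * x by rewrite ler_peMr// mulr_ge0.
move: h1; set P := (x + 1) * (_ - _) => h1.
have e : C * x ^+ n.+1 = C * x ^+ n * x by rewrite exprSr mulrA.
have : C * x ^+ n <= C * x ^+ n.+1 by rewrite e.
have : (x + 1) * (C * x ^+ n) = C * x ^+ n.+1 + C * x ^+ n by rewrite e; ring.
lra.
Qed.

Lemma sqr_sum_le (r : seq nat) (b : nat -> R) :
  (\sum_(n <- r) b n) ^+ 2 <= (size r)%:R * \sum_(n <- r) b n ^+ 2.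
Proof.
rewrite expr2 big_distrlr /=.
have -> : (size r)%:R * \sum_(n <- r) b n ^+ 2 =
    \sum_(n <- r) \sum_(m <- r) ((b n ^+ 2 + b m ^+ 2) / 2).
  under [RHS]eq_bigr do rewrite -mulr_suml big_split /= big_const_seq count_predT iter_addr_0.
  rewrite -mulr_suml big_split /= sumrMnl big_const_seq count_predT iter_addr_0.
  rewrite -[X in X + _]mulr_natl -[X in _ + X]mulr_natl; lra.
apply: ler_sum => n _; apply: ler_sum => m _.
by have := sqr_ge0 (b n - b m); rewrite sqrrB mulr2n; lra.
Qed.

Lemma sum_inv_sqr_le n : \sum_(0 <= k < n) (k.+1%:R ^- 2 : R) <= 2.
Proof.
(* The sharper bound [2 - 1/(m+1)] is what telescoping can carry through the induction. *)
suff H m : \sum_(0 <= k < m.+1) (k.+1%:R ^- 2 : R) <= 2 - m.+1%:R^-1.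
  case: n => [|n]; first by rewrite big_nil.
  by apply: le_trans (H n) _; rewrite lerBlDr lerDl invr_ge0.
elim: m => [|m IH]; first by rewrite big_nat1; lra.
rewrite big_nat_recr//=.
have m0 : 0 < m.+1%:R :> R by rewrite ltr0n.
have e : m.+2%:R = m.+1%:R + 1 :> R by rewrite natr1.
have h : m.+2%:R ^- 2 <= m.+1%:R^-1 - m.+2%:R^-1 :> R.
  have -> : m.+1%:R^-1 - m.+2%:R^-1 = (m.+1%:R * m.+2%:R)^-1 :> R.
    by rewrite e; field; rewrite !gt_eqF// addr_gt0.
  by rewrite lef_pV2 ?posrE ?exprn_gt0 ?mulr_gt0 ?ltr0n// expr2 ler_wpM2r// ler_nat.
by apply: le_trans (lerD IH h) _; rewrite addrA subrK.
Qed.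

End Elementary.

(** * Pointwise control of all averages in a block of lengths *)

Section BlockEnergy.
Context {R : realType}.
Implicit Types (net : seq R) (b : nat -> R[i]).

Definition exp_sum (b : nat -> R[i]) (theta : R) (N : nat) : R[i] :=
  \sum_(1 <= n < N.+1) e1 (n%:R * theta) * b n.

Definition energy (b : nat -> R[i]) (M N : nat) : R :=
  \sum_(M <= n < N) Normc.normc (b n) ^+ 2.

(* Dominates the averages of length [N] with [k^16 <= N <= (k+1)^16]: the
   three terms control, in this order, the points of the net at length [k^16],
   the passage from the net to a nearby frequency, and the change of length. *)
Definition block_energy net b (k : nat) : R :=
  k%:R ^- 32 * \sum_(theta <- net) Normc.normc (exp_sum b theta (k ^ 16)) ^+ 2 +
  k%:R ^- 48 * energy b 1 (k ^ 16).+1 +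
  k%:R ^- 32 * (k.+1 ^ 16 - k ^ 16)%:R * energy b (k ^ 16).+1 (k.+1 ^ 16).+1.

Lemma energy_ge0 b M N : 0 <= energy b M N.
Proof. by apply: sumr_ge0 => n _; rewrite sqr_ge0. Qed.

Lemma sum_normc_sqr_le b M N :
  (\sum_(M <= n < N) Normc.normc (b n)) ^+ 2 <= (N - M)%:R * energy b M N.
Proof. by apply: le_trans (sqr_sum_le _ _) _; rewrite size_iota. Qed.

Lemma block_energy_ge0 net b k : 0 <= block_energy net b k.
Proof.
rewrite !addr_ge0// ?mulr_ge0 ?invr_ge0 ?exprn_ge0 ?energy_ge0//.
by apply: sumr_ge0 => n _; rewrite sqr_ge0.
Qed.

Lemma exp_sum_average_le net b k N (theta theta' ep : R) : (0 < k)%N ->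
  (k ^ 16 <= N <= k.+1 ^ 16)%N -> theta' \in net ->
  `|theta - theta'| <= k%:R ^- 32 -> 0 <= ep -> block_energy net b k <= ep ^+ 2 ->
  Normc.normc (N%:R^-1 * exp_sum b theta N) <= 18 * ep.
Proof.
move=> k0 /andP[kN Nk] th'net thth' ep0 Wep; set x : R := k%:R.
have x1 : 1 <= x by rewrite ler1n.
have x0 : 0 < x by rewrite ltr0n.
have xX n : 0 < x ^+ n by rewrite exprn_gt0.
have xV n : 0 <= x ^- n by rewrite invr_ge0 ltW.
have K0 : (0 < k ^ 16)%N by rewrite expn_gt0 k0.
have sqle y : 0 <= y -> y ^+ 2 <= ep ^+ 2 -> y <= ep.
  by move=> y0; rewrite ler_pXn2r ?nnegrE.
pose t1 := x ^- 32 * \sum_(th <- net) Normc.normc (exp_sum b th (k ^ 16)) ^+ 2.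
pose t2 := x ^- 48 * energy b 1 (k ^ 16).+1.
pose t3 := x ^- 32 * (k.+1 ^ 16 - k ^ 16)%:R * energy b (k ^ 16).+1 (k.+1 ^ 16).+1.
have t10 : 0 <= t1 by rewrite mulr_ge0// sumr_ge0// => n _; rewrite sqr_ge0.
have t20 : 0 <= t2 by rewrite mulr_ge0// energy_ge0.
have t30 : 0 <= t3 by rewrite !mulr_ge0// energy_ge0.
have Wt : t1 + t2 + t3 <= ep ^+ 2 by exact: Wep.
pose s2 := \sum_(1 <= n < (k ^ 16).+1) Normc.normc (b n).
pose s3 := \sum_((k ^ 16).+1 <= n < (k.+1 ^ 16).+1) Normc.normc (b n).
(* The squares of the three quantities in [y1], [y2], [y3] are dominated by [t1], [t2], [t3], the
   last two through Cauchy-Schwarz. *)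
have y1 : x ^- 16 * Normc.normc (exp_sum b theta' (k ^ 16)) <= ep.
  apply: sqle; first by rewrite mulr_ge0// normc_ge0.
  apply: (@le_trans _ _ t1); last by lra.
  rewrite exprMn -exprVn -exprM exprVn /t1 ler_wpM2l//.
  rewrite (big_rem _ th'net) /= lerDl.
  by apply: sumr_ge0 => n _; rewrite sqr_ge0.
have y2 : x ^- 32 * s2 <= ep.
  apply: sqle; first by rewrite mulr_ge0// sumr_ge0// => n _; exact: normc_ge0.
  apply: (@le_trans _ _ t2); last by lra.
  rewrite exprMn -exprVn -exprM exprVn /t2.
  have h := sum_normc_sqr_le b 1 (k ^ 16).+1.
  rewrite subSS subn0 natrX -/x in h.
  apply: le_trans (ler_wpM2l (xV _) h) _; rewrite mulrA ler_wpM2r ?energy_ge0//.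
  by rewrite -[(32 * 2)%N]/(16 + 48)%N exprD invfM mulrAC mulVf ?mul1r// gt_eqF.
have y3 : x ^- 16 * s3 <= ep.
  apply: sqle; first by rewrite mulr_ge0// sumr_ge0// => n _; exact: normc_ge0.
  apply: (@le_trans _ _ t3); last by lra.
  rewrite exprMn -exprVn -exprM exprVn /t3 -mulrA ler_wpM2l//.
  by apply: le_trans (sum_normc_sqr_le _ _ _) _; rewrite subSS.
(* For [n <= k^16] the change of frequency moves the phase by at most [k^16 k^-32 = k^-16], at
   Lipschitz cost 16. After normalization the three parts weigh 1, 16 and 1, which gives 18. *)
have bound : Normc.normc (exp_sum b theta N) <=
    Normc.normc (exp_sum b theta' (k ^ 16)) + 16 * x ^- 16 * s2 + s3.
  rewrite /exp_sum (@big_cat_nat _ _ _ (k ^ 16).+1)//=.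
  apply: le_trans (normcD_le _ _) _; apply: lerD; last first.
    apply: le_trans (normc_sum _ _ _) _.
    under eq_bigr do rewrite Normc.normcM normc_e1 mul1r.
    rewrite /s3 [leRHS](@big_cat_nat _ _ _ N.+1)//= lerDl.
    by apply: sumr_ge0 => n _; exact: normc_ge0.
  have -> : \sum_(1 <= n < (k ^ 16).+1) e1 (n%:R * theta) * b n =
     \sum_(1 <= n < (k ^ 16).+1) e1 (n%:R * theta') * b n +
     \sum_(1 <= n < (k ^ 16).+1) (e1 (n%:R * theta) - e1 (n%:R * theta')) * b n.
    by rewrite -big_split /=; apply: eq_bigr => n _; ring.
  apply: le_trans (normcD_le _ _) _; rewrite lerD2l.
  apply: le_trans (normc_sum _ _ _) _; rewrite mulr_sumr.
  apply: ler_sum_nat => n /andP[_ nk]; rewrite Normc.normcM ler_wpM2r ?normc_ge0//.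
  apply: le_trans (normc_e1_subr_le _ _) _; rewrite -mulrBr normrM normr_nat.
  rewrite ler_wpM2l//.
  apply: (@le_trans _ _ (x ^+ 16 * x ^- 32)).
    by rewrite ler_pM// -natrX ler_nat.
  by rewrite -[32%N]/(16 + 16)%N exprD invfM mulrA mulfV ?mul1r// gt_eqF.
rewrite Normc.normcM Normc.normcV normc_nat.
apply: (@le_trans _ _ (x ^- 16 * Normc.normc (exp_sum b theta N))).
  rewrite ler_wpM2r ?normc_ge0// -natrX lef_pV2 ?posrE ?ltr0n ?ler_nat//.
  exact: leq_trans kN.
apply: le_trans (ler_wpM2l (xV _) bound) _.
have -> : x ^- 16 * (Normc.normc (exp_sum b theta' (k ^ 16)) + 16 * x ^- 16 * s2 + s3) =
   x ^- 16 * Normc.normc (exp_sum b theta' (k ^ 16)) + 16 * (x ^- 32 * s2) + x ^- 16 * s3.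
  have -> : x ^- 32 = x ^- 16 * x ^- 16 by rewrite -invfM -exprD.
  by move: (x ^- 16) => v; ring.
lra.
Qed.

End BlockEnergy.

(** * Integrals of the block energies *)

Section IntegralEnergy.
Context d (X : measurableType d) (R : realType).
Context (mu : probability X R) (T : X -> X) (T_mp : measure_preserving mu T).
Context (f : X -> R[i]) (mf : complex_measurable f).

Let orbit (x : X) (n : nat) : R[i] := f (iter (n ^ 2) T x).
Let J : \bar R := (\int[mu]_x (Normc.normc (f x) ^+ 2)%:E)%E.

Lemma measurable_exp_sum theta N :
  measurable_fun setT (fun x => Normc.normc (exp_sum (orbit x) theta N) ^+ 2).
Proof.
apply: measurable_sqr_normc; apply: complex_measurable_sum => n.
by apply: complex_measurableZ; exact: (complex_measurable_iter T_mp (n ^ 2) mf).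
Qed.

Lemma measurable_energy M N : measurable_fun setT (fun x => energy (orbit x) M N).
Proof.
apply: measurable_sum => n; apply: measurable_sqr_normc.
exact: (complex_measurable_iter T_mp (n ^ 2) mf).
Qed.

Lemma measurable_block_energy net k :
  measurable_fun setT (fun x => block_energy net (orbit x) k).
Proof.
apply: measurable_funD; first apply: measurable_funD.
- apply: measurable_funM; first exact: measurable_cst.
  by apply: measurable_sum => theta; exact: measurable_exp_sum.
- by apply: measurable_funM; [exact: measurable_cst|exact: measurable_energy].
- by apply: measurable_funM; [exact: measurable_cst|exact: measurable_energy].
Qed.

Lemma integral_energy M N :
  (\int[mu]_x (energy (orbit x) M N)%:E = (N - M)%:R%:E * J)%E.
Proof.
under eq_integral do rewrite /energy -sumEFin.
rewrite ge0_integral_sum//; last 2 first.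
- move=> n; apply/measurable_EFinP; apply: measurable_sqr_normc.
  exact: (complex_measurable_iter T_mp (n ^ 2) mf).
- by move=> n x _; rewrite lee_fin sqr_ge0.
rewrite (eq_bigr (fun=> J)) ?sumr_const_nat ?mule_natl// => n _.
apply: (@integral_iter _ _ _ mu T T_mp _ (fun x => (Normc.normc (f x) ^+ 2)%:E)).
  by apply/measurable_EFinP; exact: measurable_sqr_normc.
by move=> x; rewrite lee_fin sqr_ge0.
Qed.

(** The Fourier multiplier of this sum along squares is [weyl_sum theta t], whose bound is uniform
    in [t]. *)
Lemma integral_exp_sum_le c theta k : 0 < c -> badly_approximable c theta ->
  (0 < k)%N ->
  (\int[mu]_x (Normc.normc (exp_sum (orbit x) theta (k ^ 16)) ^+ 2)%:E <=
    (2 * (weyl_const c * k%:R ^+ 28))%:E * J)%E.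
Proof.
move=> c0 bad k0; apply: integral_transference => // t.
apply: le_trans (weyl_sum_bound t c0 bad k0); rewrite /weyl_sum.
by under eq_bigr do rewrite -e1D.
Qed.

Lemma integral_block_energy_le c : 0 < c -> exists2 C : R, 0 <= C &
  forall net k, (0 < k)%N -> {in net, forall theta, badly_approximable c theta} ->
    (size net <= k ^ 2)%N ->
    (\int[mu]_x (block_energy net (orbit x) k)%:E <= (C * k%:R ^- 2)%:E * J)%E.
Proof.
move=> c0; have [D D0 hD] := @exprn_succ_gap R 15.
have c8 : 0 <= 8 / c by rewrite divr_ge0// ltW.
have w0 : 0 <= weyl_const c by rewrite /weyl_const !addr_ge0// sqr_ge0.
(* One summand per term of [block_energy]: at most [k^2] net points with [k^-32 k^28] each, then
   [k^-48 k^16 <= k^-2], then the squared gap [(D k^15)^2] times [k^-32]. *)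
exists (2 * weyl_const c + 1 + D ^+ 2) => [|net k k0 nbad nsz].
  by rewrite !addr_ge0 ?mulr_ge0// sqr_ge0.
set x : R := k%:R.
have x1 : 1 <= x by rewrite ler1n.
have x0 : 0 < x by rewrite ltr0n.
have xX n : 0 < x ^+ n by rewrite exprn_gt0.
have xV n : 0 <= x ^- n by rewrite invr_ge0 ltW.
have J0 : (0 <= J)%E by apply: integral_ge0 => y _; rewrite lee_fin sqr_ge0.
have mE M N : measurable_fun setT (fun y => (energy (orbit y) M N)%:E).
  by apply/measurable_EFinP; exact: measurable_energy.
have mS th : measurable_fun setT
    (fun y => (Normc.normc (exp_sum (orbit y) th (k ^ 16)) ^+ 2)%:E).
  by apply/measurable_EFinP; exact: measurable_exp_sum.
have mSS : measurable_fun setT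
    (fun y => \sum_(th <- net) (Normc.normc (exp_sum (orbit y) th (k ^ 16)) ^+ 2)%:E)%E.
  by apply: emeasurable_sum => th; exact: mS.
have S0 y : (0 <= \sum_(th <- net) (Normc.normc (exp_sum (orbit y) th (k ^ 16)) ^+ 2)%:E)%E.
  by apply: sume_ge0 => th _; rewrite lee_fin sqr_ge0.
have E0 y M N : (0 <= (energy (orbit y) M N)%:E)%E by rewrite lee_fin energy_ge0.
under eq_integral => y _ do rewrite /block_energy !EFinD !(EFinM _ (energy _ _ _))
  (EFinM _ (\sum_(th <- net) _)) -sumEFin.
have mZ (h : X -> \bar R) (a : R) : measurable_fun setT h -> measurable_fun setT (fun y => a%:E * h y)%E.
  by move=> mh; apply: emeasurable_funM => //; exact: measurable_cst.
have a3 : 0 <= x ^- 32 * (k.+1 ^ 16 - k ^ 16)%:R by rewrite mulr_ge0.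
rewrite ge0_integralD//; last 4 first.
- by move=> y _; rewrite adde_ge0// mule_ge0// lee_fin.
- by apply: emeasurable_funD; exact: mZ.
- by move=> y _; rewrite mule_ge0// lee_fin.
- exact: mZ.
rewrite ge0_integralD//; last 4 first.
- by move=> y _; rewrite mule_ge0// lee_fin.
- exact: mZ.
- by move=> y _; rewrite mule_ge0// lee_fin.
- exact: mZ.
rewrite !ge0_integralZl_EFin// ge0_integral_sum//; last first.
  by move=> th y _; rewrite lee_fin sqr_ge0.
rewrite !integral_energy !subSS subn0 !muleA -!EFinM.
have sumle : (\sum_(th <- net) \int[mu]_y (Normc.normc (exp_sum (orbit y) th (k ^ 16)) ^+ 2)%:E
   <= (x ^+ 2 * (2 * (weyl_const c * x ^+ 28)))%:E * J)%E.
  apply: (@le_trans _ _ (\sum_(th <- net) (2 * (weyl_const c * x ^+ 28))%:E * J)%E).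
    rewrite big_seq [leRHS]big_seq; apply: lee_sum => th thn.
    by apply: integral_exp_sum_le => //; exact: nbad.
  rewrite (big_nth 0) sumr_const_nat subn0 -[leLHS]mule_natl muleA -EFinM.
  rewrite lee_wpmul2r// lee_fin ler_wpM2r ?mulr_ge0 ?(ltW (xX _))//.
  by rewrite -natrX ler_nat.
have c32 : (0 <= (x ^- 32)%:E :> \bar R)%E by rewrite lee_fin.
apply: (@le_trans _ _ ((x ^- 32 * (x ^+ 2 * (2 * (weyl_const c * x ^+ 28))))%:E * J +
   (x ^- 48 * (k ^ 16)%:R)%:E * J +
   (x ^- 32 * (k.+1 ^ 16 - k ^ 16)%:R * (k.+1 ^ 16 - k ^ 16)%:R)%:E * J)%E).
  by rewrite !leeD2r// [in leRHS]EFinM -muleA lee_wpmul2l.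
rewrite -!ge0_muleDl ?lee_fin ?addr_ge0 ?mulr_ge0 ?(ltW (xX _))//.
rewrite -!EFinD lee_wpmul2r// lee_fin.
have gap : (k.+1 ^ 16 - k ^ 16)%:R <= D * x ^+ 15.
  by rewrite natrB ?leq_exp2r// !natrX -natr1 hD.
have i1 : x ^- 32 * (x ^+ 2 * (2 * (weyl_const c * x ^+ 28))) = 2 * weyl_const c * x ^- 2.
  by field; rewrite gt_eqF.
have i2 : x ^- 48 * (k ^ 16)%:R <= x ^- 2.
  have -> : x ^- 48 * (k ^ 16)%:R = x ^- 32 by rewrite natrX -/x; field; rewrite gt_eqF.
  by rewrite lef_pV2 ?posrE// ler_weXn2l.
have i3 : x ^- 32 * (k.+1 ^ 16 - k ^ 16)%:R * (k.+1 ^ 16 - k ^ 16)%:R <= D ^+ 2 * x ^- 2.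
  have -> : D ^+ 2 * x ^- 2 = x ^- 32 * ((D * x ^+ 15) * (D * x ^+ 15)).
    by field; rewrite gt_eqF.
  by rewrite -mulrA ler_wpM2l// ler_pM.
rewrite i1; lra.
Qed.

End IntegralEnergy.

(** * Pointwise convergence along all lengths *)

Lemma exists_power_bracket e N k0 : (0 < e)%N -> (k0 ^ e <= N)%N ->
  exists2 k, (k0 <= k)%N & (k ^ e <= N < k.+1 ^ e)%N.
Proof.
move=> e0 h; have ex : exists k, (k ^ e <= N)%N by exists k0.
have bnd k : (k ^ e <= N)%N -> (k <= N)%N.
  by apply: leq_trans; case: k => // k; rewrite -[leqLHS]expn1 leq_pexp2l.
case: (ex_maxnP ex bnd) => k kN kmax; exists k; first exact: kmax.
by rewrite kN ltnNge; apply/negP => /kmax; rewrite ltnn.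
Qed.

Theorem theorem1p8 (R : realType) (d : measure_display) (X : measurableType d)
    (mu : probability X R) (T : X -> X)
    (mu_non_atomic : non_atomic mu)
    (T_mp : measure_preserving mu T)
    (T_inv : measurably_invertible T)
    (T_erg : ergodic mu T)
    (c : R) (c_gt0 : 0 < c) (c_lt1 : c < 1)
    (E : set R) (E_sub : E `<=` `[0, 1]%classic)
    (E_bad : forall theta, E theta -> badly_approximable c theta)
    (E_dim : (upper_minkowski_dim E < (1 / 16 : R)%:E)%E)
    (f : X -> R[i]) (f_L2 : complex_L2 mu f) :
  exists X' : set X, [/\ measurable X', mu X' = 1%E &
    forall x, X' x ->
      (fun N : nat => sup [set Normc.normc (twisted_square_average T f N theta x)
                          | theta in E]) @ \oo --> (0 : R)].
Proof.
have [mRe mIm Jfin] := f_L2; have mf : complex_measurable f by [].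
have [net [k0 [k00 netE netsz netP]]] := minkowski_nets E_sub E_dim.
have [C C0 hC] := @integral_block_energy_le _ _ _ mu T T_mp f mf c c_gt0.
set J := (\int[mu]_x (Normc.normc (f x) ^+ 2)%:E)%E in Jfin hC.
have J0 : (0 <= J)%E by apply: integral_ge0 => y _; rewrite lee_fin sqr_ge0.
have JE : J = (fine J)%:E by rewrite fineK// ge0_fin_numE.
(* The index is shifted by one so that the negative powers of the block index are never taken at
   0. *)
pose W k x := block_energy (net k.+1) (fun n => f (iter (n ^ 2) T x)) k.+1.
have [||||X' [mX' muX' WX']] := @ae_cvg0_of_summable _ _ _ mu W
    (fun k => C * fine J * k.+1%:R ^- 2) (C * fine J * 2).
- by move=> k; exact: (measurable_block_energy T_mp mf).
- by move=> k x; exact: block_energy_ge0.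
- move=> k; rewrite mulrAC EFinM -JE; apply: hC => //.
  by move=> theta /netE; exact: E_bad.
- move=> n; rewrite -mulr_sumr ler_wpM2l ?sum_inv_sqr_le//.
  by rewrite mulr_ge0// fine_ge0.
exists X'; split => // x X'x; apply/cvgrPdist_lt => ep ep0.
(* [18 * (ep / 36) = ep / 2] leaves room for the strict inequality after taking a supremum. *)
have ep36 : 0 < ep / 36 by rewrite divr_gt0.
have /cvgrPdist_lt/(_ _ (exprn_gt0 2 ep36))[K _ hK] := WX' _ X'x.
near=> N; rewrite sub0r normrN.
have [k kK /andP[kN Nk]] : exists2 k, (maxn k0 K.+1 <= k)%N & (k ^ 16 <= N < k.+1 ^ 16)%N.
  by apply: exists_power_bracket => //; near: N; exact: nbhs_infty_ge.
have kk0 : (k0 <= k)%N by rewrite (leq_trans _ kK)// leq_maxl.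
have kK1 : (K < k)%N by rewrite (leq_trans _ kK)// leq_maxr.
have k_gt0 : (0 < k)%N by rewrite (leq_trans k00).
have Wk : block_energy (net k) (fun n => f (iter (n ^ 2) T x)) k <= (ep / 36) ^+ 2.
  have := hK k.-1; rewrite /= /W prednK// => /(_ _); rewrite -ltnS prednK// => /(_ kK1).
  by rewrite sub0r normrN => /ltW; apply: le_trans; exact: ler_norm.
set A := [set _ | _ in _].
have Ale a : A a -> 0 <= a <= ep / 2.
  move=> [theta Etheta <-]; rewrite normc_ge0 /=.
  have [theta' th'net near_th] := netP k kk0 theta Etheta.
  have -> : ep / 2 = 18 * (ep / 36) by lra.
  apply: exp_sum_average_le th'net near_th (ltW ep36) Wk => //.
  by rewrite kN ltnW.
(* For empty [E] the supremum is 0 by convention. *)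
have [A0|/set0P[a Aa]] := eqVneq A set0; first by rewrite A0 sup0 normr0.
have supA : sup A <= ep / 2.
  by apply: ge_sup; [exists a|move=> b /Ale/andP[]].
have a_le : a <= sup A.
  by apply: ub_le_sup => //; exists (ep / 2) => b /Ale/andP[].
have /andP[a0 _] := Ale a Aa.
rewrite ger0_norm ?(le_trans a0)//; lra.
Unshelve. all: by end_near.
Qed.
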